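(* Let $\mu>0$ and let $\gamma_t$ be a solution of the elastic flow of closed curves in $[0,+\infty)$ with initial datum $\gamma_0$. Then, up to subsequences, reparametrization, and translations, the curve $\gamma_t$ converges to an elastica as $t\to\infty$.
   Context: For a regular planar curve $\gamma$: $\partial_s=|\partial_x\gamma|^{-1}\partial_x$, $\tau=\partial_s\gamma$, $\nu$ is the counterclockwise rotation of $\tau$ by $\pi/2$, $k$ is the oriented curvature ($\partial_s^2\gamma=k\nu$), $\mathrm{d}s=|\partial_x\gamma|\,\mathrm{d}x$. The elastic energy is $\mathcal{E}_\mu(\gamma)=\int_\gamma(k^2+\mu)\,\mathrm{d}s$. A solution of the elastic flow of closed curves in $[0,+\infty)$ is a family of closed regular curves $\gamma_t=\gamma(t,\cdot)$ in $\mathbb{R}^2$, with $\gamma(0,\cdot)=\gamma_0\in C^{4+\alpha}$ ($\alpha\in(0,1)$), of parabolic Hölder class $C^{\frac{4+\alpha}{4},4+\alpha}$ on bounded time intervals $[0,T]$ and smooth for $t>0$, such that $$\langle\partial_t\gamma,\nu\rangle=-2\partial_s^2k-k^3+\mu k$$ (the tangential velocity is not prescribed). An elastica is a critical point of the energy $\mathcal{E}_\mu$. Convergence up to subsequences, reparametrization and translations means that the solution converges to an elastica along an increasing sequence of times, up to reparametrization and translation in the ambient space $\mathbb{R}^2$. *)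

(* Defs.v *)
From Stdlib Require Import Reals.
From Coquelicot Require Import Coquelicot.
Open Scope R_scope.

(** Planar curves are maps [R -> R * R]; closed curves are 1-periodic ones, that
    is, maps on the circle [R/Z].  Coquelicot's [norm] on [R * R] is Euclidean. *)

Definition dot (v w : R * R) : R := fst v * fst w + snd v * snd w.

Definition rot (v : R * R) : R * R := (- snd v, fst v).

Definition closed_curve (c : R -> R * R) : Prop := forall x, c (x + 1) = c x.

Definition smooth (f : R -> R) : Prop := forall n x, ex_derive_n f n x.

Definition smooth_curve (c : R -> R * R) : Prop :=
  smooth (fun x => fst (c x)) /\ smooth (fun x => snd (c x)).

Definition Derive_n_vec (c : R -> R * R) (n : nat) (x : R) : R * R :=
  (Derive_n (fun y => fst (c y)) n x, Derive_n (fun y => snd (c y)) n x).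

Definition Derive_vec (c : R -> R * R) (x : R) : R * R :=
  (Derive (fun y => fst (c y)) x, Derive (fun y => snd (c y)) x).

(** [Derive] is a junk value at points of non-differentiability, so [regular]
    is only meaningful together with a differentiability hypothesis. *)
Definition regular (c : R -> R * R) : Prop := forall x, Derive_vec c x <> (0, 0).

Definition speed (c : R -> R * R) (x : R) : R := norm (Derive_vec c x).

Definition Ds (c : R -> R * R) (f : R -> R) (x : R) : R :=
  / speed c x * Derive f x.

Definition Ds_vec (c f : R -> R * R) (x : R) : R * R :=
  scal (/ speed c x) (Derive_vec f x).

Definition tangent (c : R -> R * R) : R -> R * R := Ds_vec c c.

Definition normal (c : R -> R * R) (x : R) : R * R := rot (tangent c x).

(** [Ds_vec c (tangent c)] is orthogonal to [tangent c], hence equal to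
    [scal (curvature c x) (normal c x)]. *)
Definition curvature (c : R -> R * R) (x : R) : R :=
  dot (Ds_vec c (tangent c) x) (normal c x).

Definition elastic_energy (mu : R) (c : R -> R * R) : R :=
  RInt (fun x => ((curvature c x) ^ 2 + mu) * speed c x) 0 1.

Definition elastica (mu : R) (c : R -> R * R) : Prop :=
  closed_curve c /\ smooth_curve c /\ regular c /\
  forall eta : R -> R * R, closed_curve eta -> smooth_curve eta ->
    is_derive
      (fun e : R => elastic_energy mu (fun x => plus (c x) (scal e (eta x)))) 0 0.

(** Derivative relative to a set [D]; one-sided at the end points of an interval. *)
Definition is_derive_within (D : R -> Prop) (f : R -> R) (t l : R) : Prop :=
  filterlim (fun s => (f s - f t) / (s - t))
    (within (fun s => D s /\ s <> t) (locally t)) (locally l).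

(** The points are required to be distinct because [Rpower 0 rho] is [1]. *)
Definition holder (D : R -> Prop) (rho C : R) (f : R -> R) : Prop :=
  forall x y, D x -> D y -> x <> y ->
    Rabs (f x - f y) <= C * Rpower (Rabs (x - y)) rho.

Definition holder_class (k : nat) (alpha : R) (f : R -> R) : Prop :=
  (forall j x, (j <= k)%nat -> ex_derive_n f j x) /\
  (forall j, (j <= k)%nat -> exists M, forall x, Rabs (Derive_n f j x) <= M) /\
  exists C, holder (fun _ => True) alpha C (Derive_n f k).

(** The parabolic space $C^{\frac{k+\alpha}{4},k+\alpha}([0,T]\times\mathbb R)$:
    [D i j] is the derivative of order [i] in time and [j] in space. *)
Definition parabolic_holder_class
    (k : nat) (alpha T : R) (u : R -> R -> R) : Prop :=
  exists D : nat -> nat -> R -> R -> R,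
    (forall t x, 0 <= t <= T -> D 0%nat 0%nat t x = u t x) /\
    (forall i j t x, (4 * i + j + 1 <= k)%nat -> 0 <= t <= T ->
       is_derive (D i j t) x (D i (S j) t x)) /\
    (forall i j t x, (4 * i + j + 4 <= k)%nat -> 0 <= t <= T ->
       is_derive_within (fun s => 0 <= s <= T)
         (fun s => D i j s x) t (D (S i) j t x)) /\
    (forall i j, (4 * i + j <= k)%nat ->
       continuous_on (fun p : R * R => 0 <= fst p <= T)
         (fun p : R * R => D i j (fst p) (snd p))) /\
    (forall i j, (4 * i + j <= k)%nat ->
       exists M, forall t x, 0 <= t <= T -> Rabs (D i j t x) <= M) /\
    (forall i j, (4 * i + j = k)%nat ->
       exists C, forall t, 0 <= t <= T -> holder (fun _ => True) alpha C (D i j t)) /\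
    (forall i j, (4 * i + j <= k)%nat ->
       0 < INR k + alpha - INR (4 * i + j) < 4 ->
       exists C, forall x,
         holder (fun s => 0 <= s <= T) ((INR k + alpha - INR (4 * i + j)) / 4) C
           (fun s => D i j s x)).

(** The first argument of [g] is time, the second one the space parameter. *)
Record elastic_flow (mu alpha : R) (g0 : R -> R * R) (g : R -> R -> R * R) : Prop :=
  { flow_closed : forall t, 0 <= t -> closed_curve (g t);
    flow_regular : forall t, 0 <= t -> regular (g t);
    flow_initial_class :
      holder_class 4 alpha (fun x => fst (g0 x)) /\
      holder_class 4 alpha (fun x => snd (g0 x));
    flow_initial : forall x, g 0 x = g0 x;
    flow_class : forall T, 0 < T ->
      parabolic_holder_class 4 alpha T (fun t x => fst (g t x)) /\
      parabolic_holder_class 4 alpha T (fun t x => snd (g t x));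
    flow_smooth : forall n t x, 0 < t ->
      ex_diff_n (fun s y => fst (g s y)) n t x /\
      ex_diff_n (fun s y => snd (g s y)) n t x;
    flow_motion : forall t x, 0 <= t ->
      exists v : R * R,
        is_derive_within (fun s => 0 <= s) (fun s => fst (g s x)) t (fst v) /\
        is_derive_within (fun s => 0 <= s) (fun s => snd (g s x)) t (snd v) /\
        dot v (normal (g t) x) =
          - 2 * Ds (g t) (Ds (g t) (curvature (g t))) x
          - (curvature (g t) x) ^ 3 + mu * curvature (g t) x }.

(** Lift to [R] of an orientation preserving smooth diffeomorphism of [R/Z]. *)
Definition reparametrization (phi : R -> R) : Prop :=
  smooth phi /\ (forall x, 0 < Derive phi x) /\ (forall x, phi (x + 1) = phi x + 1).

Definition smooth_convergence (c : nat -> R -> R * R) (l : R -> R * R) : Prop :=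
  forall m : nat, forall eps, 0 < eps ->
    exists N : nat, forall n : nat, (N <= n)%nat -> forall x,
      norm (minus (Derive_n_vec (c n) m x) (Derive_n_vec l m x)) < eps.

(* Main.v *)
Require Import Defs.
From Stdlib Require Import Reals Lra Lia ZArith Cantor IndefiniteDescription.
From Coquelicot Require Import Coquelicot.
Open Scope R_scope.

(** The elastic flow is the [L^2] gradient flow of the elastic energy: the energy
    decreases at the rate [int V^2 ds], with [V] the normal velocity.  Hence for
    [t >= 1] both [int k^2 ds] and the length are bounded above, and the length is
    bounded below because a closed curve has total curvature at least of order
    one ([len_ge]).

    These bounds control every derivative of curvature.  In the normal time
    derivative [normal_dt] the tangential velocity drops out, and
    [dsk j], the [j]-th arclength derivative of [k], satisfies a fourth order
    equation with cubic remainder ([Dn_dsk]).  Interpolation between [int k^2] and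
    [int (dsk (j + 2))^2] shows that the remainder is dominated by the dissipative
    term, so that [int (dsk j)^2] solves a differential inequality
    [F' + F <= K] and stays bounded ([q_dsk_bounded]).

    Since the total dissipation is finite, [int V^2 ds] tends to zero along some
    increasing sequence of times, and with the bounds so does the sup norm of [V]
    ([V_vanishes]).  At these times the curves are reparametrized with constant
    speed and translated to start at the origin; space derivatives are then powers
    of the length times arclength derivatives, all bounded, and a subsequence
    converges with all derivatives ([smooth_compactness]).  The limit has constant
    positive speed and satisfies [2 k_ss + k^3 - mu k = 0], because this quantity is
    [- V] along the sequence and, after multiplication by a power of the speed, a
    polynomial in the derivatives of the coordinates ([elastica_poly]).  By the first
    variation formula ([first_variation]) the limit is a critical point. *)

(** * Smooth families of functions on the circle *)

Definition dt (f : R -> R -> R) (t x : R) : R := Derive (fun s => f s x) t.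
Definition dx (f : R -> R -> R) (t x : R) : R := Derive (fun y => f t y) x.

Definition fconst (c : R) : R -> R -> R := fun _ _ => c.
Definition fadd (f g : R -> R -> R) : R -> R -> R := fun t x => f t x + g t x.
Definition fmul (f g : R -> R -> R) : R -> R -> R := fun t x => f t x * g t x.

Section SmoothFunctions.

Variable I : R -> Prop.
Hypothesis I_open : forall t, I t -> locally t I.

Definition eqI (f g : R -> R -> R) : Prop := forall t x, I t -> f t x = g t x.

(** Joint differentiability class of a function of time [t] in [I] and space
    [x] in [R].  Unlike a pointwise class it is quantified over the whole strip,
    which lets closure under products, inverses and roots go by induction on
    [n], every partial derivative being again in the class one order below. *)
Fixpoint class_C (n : nat) (f : R -> R -> R) : Prop :=
  (forall t x, I t -> continuity_2d_pt f t x) /\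
  match n with
  | O => True
  | S n' =>
      (forall t x, I t ->
         ex_derive (fun s => f s x) t /\ ex_derive (fun y => f t y) x) /\
      class_C n' (dt f) /\ class_C n' (dx f)
  end.

Definition smooth2 (f : R -> R -> R) : Prop := forall n, class_C n f.

Lemma dt_ext f g : eqI f g -> eqI (dt f) (dt g).
Proof.
  intros H t x Ht; apply Derive_ext_loc.
  apply (filter_imp I); [intros s Hs; apply H, Hs | apply I_open, Ht].
Qed.

Lemma dx_ext f g : eqI f g -> eqI (dx f) (dx g).
Proof. intros H t x Ht; apply Derive_ext; intro y; apply H, Ht. Qed.

Lemma eqI_sym f g : eqI f g -> eqI g f.
Proof. intros H t x Ht; symmetry; apply H, Ht. Qed.

Lemma class_C_ext n : forall f g, eqI f g -> class_C n f -> class_C n g.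
Proof.
  induction n as [|n IH]; intros f g H Hf.
  - split; [|trivial]. intros t x Ht.
    apply continuity_2d_pt_ext_loc with f; [|apply (proj1 Hf), Ht].
    destruct (I_open t Ht) as [d Hd]. exists d. intros u v Hu _.
    apply H, Hd, Hu.
  - destruct Hf as [Hc [Hd [H1 H2]]].
    split; [|split; [|split]].
    + intros t x Ht.
      apply continuity_2d_pt_ext_loc with f; [|apply Hc, Ht].
      destruct (I_open t Ht) as [d Hd']. exists d. intros u v Hu _.
      apply H, Hd', Hu.
    + intros t x Ht; destruct (Hd t x Ht) as [A B]; split.
      * apply (ex_derive_ext_loc (fun s => f s x)); [|exact A].
        apply (filter_imp I); [intros s Hs; apply H, Hs | apply I_open, Ht].
      * apply (ex_derive_ext (fun y => f t y)); [|exact B].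
        intro y; apply H, Ht.
    + apply (IH (dt f)); [apply dt_ext, H | exact H1].
    + apply (IH (dx f)); [apply dx_ext, H | exact H2].
Qed.

Lemma class_C_weaken n : forall f, class_C (S n) f -> class_C n f.
Proof.
  induction n as [|n IH]; intros f [Hc [Hd [H1 H2]]].
  - split; auto.
  - split; [exact Hc|split; [exact Hd|split; apply IH; assumption]].
Qed.

Lemma class_C_const n c : class_C n (fconst c).
Proof.
  revert c; induction n as [|n IH]; intro c.
  - split; [|trivial]. intros; apply continuity_2d_pt_const.
  - split; [|split; [|split]].
    + intros; apply continuity_2d_pt_const.
    + intros t x _; split; exact (ex_derive_const c _).
    + apply (class_C_ext n (fconst 0)); [|apply IH].
      intros t x _; symmetry; exact (Derive_const c _).
    + apply (class_C_ext n (fconst 0)); [|apply IH].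
      intros t x _; symmetry; exact (Derive_const c _).
Qed.

Lemma class_C_time n : class_C n (fun t _ => t).
Proof.
  destruct n as [|n].
  - split; [|trivial]. intros; apply continuity_2d_pt_id1.
  - split; [|split; [|split]].
    + intros; apply continuity_2d_pt_id1.
    + intros t x _; split; [exact (ex_derive_id t) | exact (ex_derive_const t x)].
    + apply (class_C_ext n (fconst 1)); [|apply class_C_const].
      intros t x _; symmetry; exact (Derive_id t).
    + apply (class_C_ext n (fconst 0)); [|apply class_C_const].
      intros t x _; symmetry; exact (Derive_const t x).
Qed.

Lemma class_C_space n : forall h : R -> R, smooth h -> class_C n (fun _ x => h x).
Proof.
  induction n as [|n IH]; intros h Hh.
  - split; [|trivial]. intros t x _.
    apply (continuity_1d_2d_pt_comp h (fun _ y => y)).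
    + apply continuity_pt_filterlim, (ex_derive_continuous h x), (Hh 1%nat x).
    + apply continuity_2d_pt_id2.
  - split; [|split; [|split]].
    + intros t x _.
      apply (continuity_1d_2d_pt_comp h (fun _ y => y)).
      * apply continuity_pt_filterlim, (ex_derive_continuous h x), (Hh 1%nat x).
      * apply continuity_2d_pt_id2.
    + intros t x _; split; [exact (ex_derive_const (h x) t) | apply (Hh 1%nat x)].
    + apply (class_C_ext n (fconst 0)); [|apply class_C_const].
      intros t x _; symmetry; exact (Derive_const (h x) t).
    + apply (IH (Derive h)). intros m x.
      destruct m as [|m]; [exact Logic.I|].
      generalize (Hh (S (S m)) x). simpl. intro H.
      apply (ex_derive_ext (Derive (Derive_n h m))); [|exact H].
      intro y. change (Derive_n h (1 + m) y = Derive_n (Derive_n h 1) m y).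
      rewrite Nat.add_comm. symmetry; apply Derive_n_comp.
Qed.

Lemma class_C_add n : forall f g, class_C n f -> class_C n g -> class_C n (fadd f g).
Proof.
  induction n as [|n IH]; intros f g Hf Hg.
  - split; [|trivial]. intros; apply continuity_2d_pt_plus;
      [apply (proj1 Hf) | apply (proj1 Hg)]; assumption.
  - destruct Hf as [Fc [Fd [F1 F2]]], Hg as [Gc [Gd [G1 G2]]].
    split; [|split; [|split]].
    + intros; apply continuity_2d_pt_plus; auto.
    + intros t x Ht; destruct (Fd t x Ht), (Gd t x Ht); split;
        apply @ex_derive_plus; assumption.
    + apply (class_C_ext n (fadd (dt f) (dt g))); [|apply IH; assumption].
      intros t x Ht; destruct (Fd t x Ht), (Gd t x Ht).
      symmetry; apply Derive_plus; assumption.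
    + apply (class_C_ext n (fadd (dx f) (dx g))); [|apply IH; assumption].
      intros t x Ht; destruct (Fd t x Ht), (Gd t x Ht).
      symmetry; apply Derive_plus; assumption.
Qed.

Lemma class_C_mul n : forall f g, class_C n f -> class_C n g -> class_C n (fmul f g).
Proof.
  induction n as [|n IH]; intros f g Hf Hg.
  - split; [|trivial]. intros; apply continuity_2d_pt_mult;
      [apply (proj1 Hf) | apply (proj1 Hg)]; assumption.
  - pose proof (class_C_weaken _ _ Hf) as Wf; pose proof (class_C_weaken _ _ Hg) as Wg.
    destruct Hf as [Fc [Fd [F1 F2]]], Hg as [Gc [Gd [G1 G2]]].
    split; [|split; [|split]].
    + intros; apply continuity_2d_pt_mult; auto.
    + intros t x Ht; destruct (Fd t x Ht), (Gd t x Ht); split;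
        apply ex_derive_mult; assumption.
    + apply (class_C_ext n (fadd (fmul (dt f) g) (fmul f (dt g))));
        [|apply class_C_add; apply IH; assumption].
      intros t x Ht; destruct (Fd t x Ht), (Gd t x Ht).
      symmetry; apply (Derive_mult (fun s => f s x) (fun s => g s x)); assumption.
    + apply (class_C_ext n (fadd (fmul (dx f) g) (fmul f (dx g))));
        [|apply class_C_add; apply IH; assumption].
      intros t x Ht; destruct (Fd t x Ht), (Gd t x Ht).
      symmetry; apply (Derive_mult (fun y => f t y) (fun y => g t y)); assumption.
Qed.

Lemma class_C_inv n : forall f, (forall t x, I t -> f t x <> 0) ->
  class_C n f -> class_C n (fun t x => / f t x).
Proof.
  induction n as [|n IH]; intros f Hnz Hf.
  - split; [|trivial]. intros; apply continuity_2d_pt_inv; auto. apply Hf; auto.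
  - pose proof (IH f Hnz (class_C_weaken _ _ Hf)) as Wi.
    destruct Hf as [Fc [Fd [F1 F2]]].
    assert (E : forall h, class_C n h ->
      class_C n (fmul (fconst (-1)) (fmul h (fmul (fun t x => / f t x) (fun t x => / f t x))))).
    { intros h Hh; repeat apply class_C_mul; auto using class_C_const. }
    split; [|split; [|split]].
    + intros; apply continuity_2d_pt_inv; auto.
    + intros t x Ht; destruct (Fd t x Ht); split; apply ex_derive_inv; auto.
    + apply (class_C_ext n _ _) with (2 := E _ F1).
      intros t x Ht; destruct (Fd t x Ht).
      unfold dt at 2. rewrite (Derive_inv (fun s => f s x)) by auto.
      unfold fmul, fconst, dt. field. auto.
    + apply (class_C_ext n _ _) with (2 := E _ F2).
      intros t x Ht; destruct (Fd t x Ht).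
      unfold dx at 2. rewrite (Derive_inv (fun y => f t y)) by auto.
      unfold fmul, fconst, dx. field. auto.
Qed.

Lemma class_C_sqrt n : forall f, (forall t x, I t -> 0 < f t x) ->
  class_C n f -> class_C n (fun t x => sqrt (f t x)).
Proof.
  induction n as [|n IH]; intros f Hpos Hf.
  - split; [|trivial]. intros t x Ht.
    apply (continuity_1d_2d_pt_comp sqrt f);
      [apply continuity_pt_sqrt, Rlt_le, Hpos, Ht | apply Hf, Ht].
  - pose proof (IH f Hpos (class_C_weaken _ _ Hf)) as Ws.
    assert (Hs : forall t x, I t -> 0 < sqrt (f t x))
      by (intros; apply sqrt_lt_R0; auto).
    assert (Wi : class_C n (fun t x => / sqrt (f t x))).
    { apply (class_C_inv n (fun t x => sqrt (f t x))); [|exact Ws].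
      intros t x Ht; specialize (Hs t x Ht); lra. }
    destruct Hf as [Fc [Fd [F1 F2]]].
    assert (E : forall h, class_C n h ->
      class_C n (fmul (fconst (/2)) (fmul h (fun t x => / sqrt (f t x))))).
    { intros h Hh; repeat apply class_C_mul; auto using class_C_const. }
    assert (D : forall (h : R -> R) u, 0 < h u -> ex_derive h u ->
       is_derive (fun y => sqrt (h y)) u (Derive h u / (2 * sqrt (h u)))).
    { intros h u Hu Hd. auto_derive; [auto|].
      change (fun x => h x) with h. field.
      apply Rgt_not_eq, sqrt_lt_R0, Hu. }
    split; [|split; [|split]].
    + intros t x Ht.
      apply (continuity_1d_2d_pt_comp sqrt f);
        [apply continuity_pt_sqrt, Rlt_le, Hpos, Ht | apply Fc, Ht].
    + intros t x Ht; destruct (Fd t x Ht); split; eexists.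
      * apply (D (fun s => f s x)); auto.
      * apply (D (fun y => f t y)); auto.
    + apply (class_C_ext n _ _) with (2 := E _ F1).
      intros t x Ht; destruct (Fd t x Ht). specialize (Hs t x Ht).
      etransitivity; [|symmetry; exact (is_derive_unique _ _ _ (D (fun s => f s x) t (Hpos t x Ht) H))].
      unfold fmul, fconst, dt. simpl. field. lra.
    + apply (class_C_ext n _ _) with (2 := E _ F2).
      intros t x Ht; destruct (Fd t x Ht). specialize (Hs t x Ht).
      etransitivity; [|symmetry; exact (is_derive_unique _ _ _ (D (fun y => f t y) x (Hpos t x Ht) H0))].
      unfold fmul, fconst, dx. simpl. field. lra.
Qed.

Lemma smooth2_dt f : smooth2 f -> smooth2 (dt f).
Proof. intros H n; exact (proj1 (proj2 (proj2 (H (S n))))). Qed.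

Lemma smooth2_dx f : smooth2 f -> smooth2 (dx f).
Proof. intros H n; exact (proj2 (proj2 (proj2 (H (S n))))). Qed.

Lemma smooth2_ex_dt f t x : smooth2 f -> I t -> ex_derive (fun s => f s x) t.
Proof. intros H Ht; exact (proj1 (proj1 (proj2 (H 1%nat)) t x Ht)). Qed.

Lemma smooth2_ex_dx f t x : smooth2 f -> I t -> ex_derive (fun y => f t y) x.
Proof. intros H Ht; exact (proj2 (proj1 (proj2 (H 1%nat)) t x Ht)). Qed.

Lemma smooth2_cont f t x : smooth2 f -> I t -> continuity_2d_pt f t x.
Proof. intros H Ht; exact (proj1 (H 0%nat) t x Ht). Qed.

Lemma smooth2_cont_x f t x : smooth2 f -> I t -> continuous (f t) x.
Proof. intros H Ht. apply (ex_derive_continuous (f t)). apply (smooth2_ex_dx f t x H Ht). Qed.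

Lemma smooth2_schwarz f : smooth2 f -> eqI (dt (dx f)) (dx (dt f)).
Proof.
  intros H t x Ht. apply (Schwarz f).
  - destruct (I_open t Ht) as [d Hd]. exists d. intros u v Hu _.
    assert (Iu : I u) by (apply Hd, Hu).
    split; [|split; [|split]].
    + apply smooth2_ex_dt; auto.
    + apply smooth2_ex_dx; auto.
    + apply (smooth2_ex_dt (dx f)); auto using smooth2_dx.
    + apply (smooth2_ex_dx (dt f)); auto using smooth2_dt.
  - apply (smooth2_cont (dt (dx f))); auto using smooth2_dx, smooth2_dt.
  - apply (smooth2_cont (dx (dt f))); auto using smooth2_dx, smooth2_dt.
Qed.

Definition circle_smooth (f : R -> R -> R) : Prop :=
  smooth2 f /\ forall t x, I t -> f t (x + 1) = f t x.

Lemma circle_smooth_ext f g : eqI f g -> circle_smooth f -> circle_smooth g.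
Proof.
  intros H [Hs Hp]; split.
  - intro n; apply (class_C_ext n f); auto.
  - intros t x Ht; rewrite <- !H by auto; auto.
Qed.

Lemma circle_smooth_const c : circle_smooth (fconst c).
Proof. split; [intro n; apply class_C_const | reflexivity]. Qed.

Lemma circle_smooth_add f g : circle_smooth f -> circle_smooth g -> circle_smooth (fadd f g).
Proof.
  intros [Fs Fp] [Gs Gp]; split; [intro n; apply class_C_add; auto|].
  intros t x Ht; unfold fadd; rewrite Fp, Gp; auto.
Qed.

Lemma circle_smooth_mul f g : circle_smooth f -> circle_smooth g -> circle_smooth (fmul f g).
Proof.
  intros [Fs Fp] [Gs Gp]; split; [intro n; apply class_C_mul; auto|].
  intros t x Ht; unfold fmul; rewrite Fp, Gp; auto.
Qed.

Lemma circle_smooth_inv f : (forall t x, I t -> f t x <> 0) -> circle_smooth f ->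
  circle_smooth (fun t x => / f t x).
Proof.
  intros Hn [Fs Fp]; split; [intro n; apply class_C_inv; auto|].
  intros t x Ht; rewrite Fp; auto.
Qed.

Lemma circle_smooth_sqrt f : (forall t x, I t -> 0 < f t x) -> circle_smooth f ->
  circle_smooth (fun t x => sqrt (f t x)).
Proof.
  intros Hn [Fs Fp]; split; [intro n; apply class_C_sqrt; auto|].
  intros t x Ht; rewrite Fp; auto.
Qed.

Lemma circle_smooth_dt f : circle_smooth f -> circle_smooth (dt f).
Proof.
  intros [Fs Fp]; split; [apply smooth2_dt, Fs|].
  intros t x Ht. apply Derive_ext_loc.
  apply (filter_imp I); [intros s Hs; apply Fp, Hs | apply I_open, Ht].
Qed.

Lemma Derive_periodic (h : R -> R) x :
  (forall y, h (y + 1) = h y) -> ex_derive h (x + 1) -> Derive h (x + 1) = Derive h x.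
Proof.
  intros Hp [l Hl]. rewrite (is_derive_unique _ _ _ Hl). symmetry.
  apply is_derive_unique.
  apply (is_derive_ext (fun y => h (y + 1))); [exact Hp|].
  replace l with (scal 1 l) by apply (scal_one l).
  apply (is_derive_comp h (fun y => y + 1)); [exact Hl|].
  auto_derive; auto; ring.
Qed.

Lemma circle_smooth_dx f : circle_smooth f -> circle_smooth (dx f).
Proof.
  intros [Fs Fp]; split; [apply smooth2_dx, Fs|].
  intros t x Ht. apply (Derive_periodic (f t)); [auto|].
  apply (smooth2_ex_dx f); auto.
Qed.

Lemma dt_add f g : circle_smooth f -> circle_smooth g -> eqI (dt (fadd f g)) (fadd (dt f) (dt g)).
Proof. intros [F _] [G _] t x Ht; apply Derive_plus; apply smooth2_ex_dt; auto. Qed.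

Lemma dx_add f g : circle_smooth f -> circle_smooth g -> eqI (dx (fadd f g)) (fadd (dx f) (dx g)).
Proof. intros [F _] [G _] t x Ht; apply Derive_plus; apply smooth2_ex_dx; auto. Qed.

Lemma dt_mul f g : circle_smooth f -> circle_smooth g ->
  eqI (dt (fmul f g)) (fadd (fmul (dt f) g) (fmul f (dt g))).
Proof.
  intros [F _] [G _] t x Ht.
  apply (Derive_mult (fun s => f s x) (fun s => g s x)); apply smooth2_ex_dt; auto.
Qed.

Lemma dx_mul f g : circle_smooth f -> circle_smooth g ->
  eqI (dx (fmul f g)) (fadd (fmul (dx f) g) (fmul f (dx g))).
Proof.
  intros [F _] [G _] t x Ht.
  apply (Derive_mult (fun y => f t y) (fun y => g t y)); apply smooth2_ex_dx; auto.
Qed.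

Lemma is_derive_integral f t : circle_smooth f -> I t ->
  is_derive (fun s => RInt (f s) 0 1) t (RInt (dt f t) 0 1).
Proof.
  intros [Fs _] Ht.
  apply (is_derive_RInt_param f 0 1 t).
  - apply (filter_imp I); [|apply I_open, Ht]. intros s Hs y _.
    apply smooth2_ex_dt; auto.
  - intros y _. apply (smooth2_cont (dt f)); auto using smooth2_dt.
  - apply (filter_imp I); [|apply I_open, Ht]. intros s Hs.
    apply (ex_RInt_continuous (f s)). intros z _. apply smooth2_cont_x; auto.
Qed.

End SmoothFunctions.

(** * Geometry of a smooth family of closed curves *)

Lemma speed_sqrt (c : R -> R * R) x :
  speed c x = sqrt (Derive (fun y => fst (c y)) x * Derive (fun y => fst (c y)) x
                    + Derive (fun y => snd (c y)) x * Derive (fun y => snd (c y)) x).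
Proof.
  unfold speed, Derive_vec, norm; simpl; unfold prod_norm; simpl.
  f_equal. unfold norm; simpl; unfold abs; simpl.
  rewrite !Rmult_1_r. rewrite <- !Rabs_mult.
  f_equal; apply Rabs_pos_eq, Rle_0_sqr.
Qed.

Record family (I : R -> Prop) (ga : R -> R -> R * R) : Prop :=
  { family_open : forall t, I t -> locally t I;
    family_fst : circle_smooth I (fun t x => fst (ga t x));
    family_snd : circle_smooth I (fun t x => snd (ga t x));
    family_regular : forall t, I t -> regular (ga t) }.

Create HintDb smoothness.
#[export] Hint Resolve circle_smooth_add circle_smooth_mul circle_smooth_const
  circle_smooth_dt circle_smooth_dx : smoothness.
Ltac smoothness := auto 10 with smoothness.

Section Geometry.

Variable ga : R -> R -> R * R.

Definition cx (t x : R) : R := fst (ga t x).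
Definition cy (t x : R) : R := snd (ga t x).
(** The moving frame: [(cx, cy)] is the curve, [w] its length element,
    [(ta, tb)] its unit tangent, hence [(- tb, ta)] its normal; the velocity of
    the family is [V] times the normal plus [phi] times the tangent. *)
Definition w (t x : R) : R := speed (ga t) x.
Definition ds (f : R -> R -> R) (t x : R) : R := Ds (ga t) (f t) x.
Definition ta (t x : R) : R := fst (tangent (ga t) x).
Definition tb (t x : R) : R := snd (tangent (ga t) x).
Definition k (t x : R) : R := curvature (ga t) x.
Definition V (t x : R) : R := - tb t x * dt cx t x + ta t x * dt cy t x.
Definition phi (t x : R) : R := ta t x * dt cx t x + tb t x * dt cy t x.
(** Time derivative along the normal motion.  Subtracting the transport by the
    tangential velocity makes it a derivation that does not see the choice of
    parametrization: [phi] disappears from all the evolution equations. *)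
Definition normal_dt (f : R -> R -> R) : R -> R -> R :=
  fun t x => dt f t x - phi t x * ds f t x.
Definition arc_integral (f : R -> R -> R) (t : R) : R := RInt (fun x => f t x * w t x) 0 1.

Variable I : R -> Prop.
Hypothesis fam : family I ga.

Let I_open := family_open I ga fam.
Let cx_smooth : circle_smooth I cx := family_fst I ga fam.
Let cy_smooth : circle_smooth I cy := family_snd I ga fam.

Lemma w_eq t x : w t x = sqrt (dx cx t x * dx cx t x + dx cy t x * dx cy t x).
Proof. apply speed_sqrt. Qed.

Lemma speed2_pos t x : I t -> 0 < dx cx t x * dx cx t x + dx cy t x * dx cy t x.
Proof.
  intro Ht. pose proof (family_regular I ga fam t Ht x) as H.
  destruct (Req_dec (dx cx t x) 0) as [E|E].
  - destruct (Req_dec (dx cy t x) 0) as [E'|E'].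
    + exfalso; apply H. unfold Derive_vec. f_equal; assumption.
    + nra.
  - nra.
Qed.

Lemma w_pos t x : I t -> 0 < w t x.
Proof. intro Ht; rewrite w_eq; apply sqrt_lt_R0, speed2_pos, Ht. Qed.

Lemma w_sqr t x : w t x * w t x = dx cx t x * dx cx t x + dx cy t x * dx cy t x.
Proof. rewrite w_eq. apply sqrt_sqrt. nra. Qed.

Lemma circle_smooth_w : circle_smooth I w.
Proof.
  apply (circle_smooth_ext I I_open
    (fun t x => sqrt (fadd (fmul (dx cx) (dx cx)) (fmul (dx cy) (dx cy)) t x))).
  - intros t x _; symmetry; apply w_eq.
  - apply circle_smooth_sqrt; auto.
    + intros t x Ht; apply speed2_pos, Ht.
    + apply circle_smooth_add; auto; apply circle_smooth_mul; auto; apply circle_smooth_dx; auto.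
Qed.

Lemma circle_smooth_ds f : circle_smooth I f -> circle_smooth I (ds f).
Proof.
  intro Hf. apply (circle_smooth_mul I I_open (fun t x => / w t x) (dx f)).
  - apply circle_smooth_inv; auto using circle_smooth_w.
    intros t x Ht; apply Rgt_not_eq, w_pos, Ht.
  - apply circle_smooth_dx; auto.
Qed.

#[local] Hint Resolve circle_smooth_ds circle_smooth_w : smoothness.

Lemma dx_ds f t x : I t -> dx f t x = w t x * ds f t x.
Proof.
  intro Ht. unfold ds, Ds. change (Derive (f t) x) with (dx f t x).
  change (speed (ga t) x) with (w t x).
  field. apply Rgt_not_eq, w_pos, Ht.
Qed.

Lemma ds_cx t x : ds cx t x = ta t x.
Proof. reflexivity. Qed.

Lemma ds_cy t x : ds cy t x = tb t x.
Proof. reflexivity. Qed.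

Lemma circle_smooth_ta : circle_smooth I ta.
Proof. exact (circle_smooth_ds cx cx_smooth). Qed.
#[local] Hint Resolve circle_smooth_ta : smoothness.

Lemma circle_smooth_tb : circle_smooth I tb.
Proof. exact (circle_smooth_ds cy cy_smooth). Qed.
#[local] Hint Resolve circle_smooth_tb : smoothness.

Lemma tangent_unit t x : I t -> ta t x * ta t x + tb t x * tb t x = 1.
Proof.
  intro Ht. pose proof (w_pos t x Ht) as Hw. pose proof (w_sqr t x) as E.
  rewrite (dx_ds cx t x Ht), (dx_ds cy t x Ht), ds_cx, ds_cy in E.
  apply Rmult_eq_reg_l with (w t x * w t x); [|nra].
  rewrite E at 2. ring.
Qed.

Lemma ds_ext f g : eqI I f g -> eqI I (ds f) (ds g).
Proof.
  intros H t x Ht. unfold ds, Ds. f_equal. apply (dx_ext I f g H t x Ht).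
Qed.

Lemma ds_add f g t x : circle_smooth I f -> circle_smooth I g -> I t ->
  ds (fadd f g) t x = ds f t x + ds g t x.
Proof.
  intros Hf Hg Ht. unfold ds, Ds.
  change (Derive (fadd f g t) x) with (dx (fadd f g) t x).
  rewrite (dx_add I f g Hf Hg t x Ht). unfold fadd, dx.
  change (fun y => f t y) with (f t). change (fun y => g t y) with (g t). ring.
Qed.

Lemma ds_mul f g t x : circle_smooth I f -> circle_smooth I g -> I t ->
  ds (fmul f g) t x = ds f t x * g t x + f t x * ds g t x.
Proof.
  intros Hf Hg Ht. unfold ds, Ds.
  change (Derive (fmul f g t) x) with (dx (fmul f g) t x).
  rewrite (dx_mul I f g Hf Hg t x Ht). unfold fadd, fmul, dx.
  change (fun y => f t y) with (f t). change (fun y => g t y) with (g t). ring.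
Qed.

Lemma ds_const c t x : ds (fconst c) t x = 0.
Proof.
  unfold ds, Ds. replace (Derive (fconst c t) x) with 0; [ring|].
  symmetry; exact (Derive_const c x).
Qed.

Lemma ds_scal c f t x : circle_smooth I f -> I t -> ds (fmul (fconst c) f) t x = c * ds f t x.
Proof.
  intros Hf Ht. rewrite ds_mul by smoothness.
  rewrite ds_const. unfold fconst. ring.
Qed.

Lemma k_eq t x : k t x = - ds ta t x * tb t x + ds tb t x * ta t x.
Proof.
  unfold k, curvature, dot, normal, rot. simpl.
  change (ds ta t x * - tb t x + ds tb t x * ta t x =
          - ds ta t x * tb t x + ds tb t x * ta t x). ring.
Qed.

Lemma circle_smooth_k : circle_smooth I k.
Proof.
  apply (circle_smooth_ext I I_open
    (fadd (fmul (fmul (fconst (-1)) (ds ta)) tb) (fmul (ds tb) ta))).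
  - intros t x _; rewrite k_eq; unfold fadd, fmul, fconst; ring.
  - smoothness.
Qed.
#[local] Hint Resolve circle_smooth_k : smoothness.

Lemma tangent_ds_orthogonal t x : I t -> ta t x * ds ta t x + tb t x * ds tb t x = 0.
Proof.
  intro Ht.
  assert (E : eqI I (fadd (fmul ta ta) (fmul tb tb)) (fconst 1)).
  { intros s y Hs; apply tangent_unit, Hs. }
  pose proof (ds_ext _ _ E t x Ht) as H. rewrite ds_const in H.
  rewrite ds_add, !ds_mul in H by smoothness. lra.
Qed.

(** Frenet equations; the length of [(ta, tb)] being constant, its derivative
    is normal. *)
Lemma ds_ta : eqI I (ds ta) (fmul (fconst (-1)) (fmul k tb)).
Proof.
  intros t x Ht. unfold fmul, fconst. rewrite k_eq.
  pose proof (tangent_unit t x Ht). pose proof (tangent_ds_orthogonal t x Ht).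
  transitivity (ds ta t x * (ta t x * ta t x + tb t x * tb t x)); [rewrite H; ring|].
  replace (-1 * ((- ds ta t x * tb t x + ds tb t x * ta t x) * tb t x)) with
    (ds ta t x * (tb t x * tb t x) - ta t x * (tb t x * ds tb t x)) by ring.
  replace (tb t x * ds tb t x) with (- (ta t x * ds ta t x)) by lra. ring.
Qed.

Lemma ds_tb : eqI I (ds tb) (fmul k ta).
Proof.
  intros t x Ht. unfold fmul. rewrite k_eq.
  pose proof (tangent_unit t x Ht). pose proof (tangent_ds_orthogonal t x Ht).
  transitivity (ds tb t x * (ta t x * ta t x + tb t x * tb t x)); [rewrite H; ring|].
  replace ((- ds ta t x * tb t x + ds tb t x * ta t x) * ta t x) with
    (ds tb t x * (ta t x * ta t x) - tb t x * (ta t x * ds ta t x)) by ring.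
  replace (ta t x * ds ta t x) with (- (tb t x * ds tb t x)) by lra. ring.
Qed.

Lemma circle_smooth_V : circle_smooth I V.
Proof.
  apply (circle_smooth_ext I I_open
    (fadd (fmul (fconst (-1)) (fmul tb (dt cx))) (fmul ta (dt cy)))).
  - intros t x _; unfold fadd, fmul, fconst, V; ring.
  - smoothness.
Qed.
#[local] Hint Resolve circle_smooth_V : smoothness.

Lemma circle_smooth_phi : circle_smooth I phi.
Proof.
  change (circle_smooth I (fadd (fmul ta (dt cx)) (fmul tb (dt cy)))). smoothness.
Qed.
#[local] Hint Resolve circle_smooth_phi : smoothness.

Lemma dt_cx : eqI I (dt cx) (fadd (fmul (fconst (-1)) (fmul V tb)) (fmul phi ta)).
Proof.
  intros t x Ht; unfold fadd, fmul, fconst, V, phi.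
  transitivity (dt cx t x * (ta t x * ta t x + tb t x * tb t x));
    [rewrite tangent_unit by exact Ht|]; ring.
Qed.

Lemma dt_cy : eqI I (dt cy) (fadd (fmul V ta) (fmul phi tb)).
Proof.
  intros t x Ht; unfold fadd, fmul, fconst, V, phi.
  transitivity (dt cy t x * (ta t x * ta t x + tb t x * tb t x));
    [rewrite tangent_unit by exact Ht|]; ring.
Qed.

Lemma ds_dt_cx t x : I t -> ds (dt cx) t x =
  - (ds V t x * tb t x + V t x * (k t x * ta t x))
  + (ds phi t x * ta t x - phi t x * (k t x * tb t x)).
Proof.
  intro Ht. rewrite (ds_ext _ _ dt_cx t x Ht).
  pose proof circle_smooth_V; pose proof circle_smooth_phi.
  pose proof circle_smooth_ta; pose proof circle_smooth_tb.
  rewrite ds_add, ds_scal, !ds_mul by smoothness.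
  rewrite ds_ta, ds_tb by smoothness. unfold fmul, fconst. ring.
Qed.

Lemma ds_dt_cy t x : I t -> ds (dt cy) t x =
  (ds V t x * ta t x - V t x * (k t x * tb t x))
  + (ds phi t x * tb t x + phi t x * (k t x * ta t x)).
Proof.
  intro Ht. rewrite (ds_ext _ _ dt_cy t x Ht).
  pose proof circle_smooth_V; pose proof circle_smooth_phi.
  pose proof circle_smooth_ta; pose proof circle_smooth_tb.
  rewrite ds_add, !ds_mul by smoothness.
  rewrite ds_ta, ds_tb by smoothness. unfold fmul, fconst. ring.
Qed.

Lemma dt_dx f : circle_smooth I f -> eqI I (dt (dx f)) (fmul w (ds (dt f))).
Proof.
  intros Hf t x Ht. rewrite (smooth2_schwarz I I_open f (proj1 Hf) t x Ht).
  apply dx_ds, Ht.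
Qed.

Lemma dt_w : eqI I (dt w) (fun t x => w t x * (ds phi t x - k t x * V t x)).
Proof.
  intros t x Ht. pose proof (w_pos t x Ht) as Hw.
  assert (E : eqI I (fmul w w) (fadd (fmul (dx cx) (dx cx)) (fmul (dx cy) (dx cy)))).
  { intros s y _; apply w_sqr. }
  pose proof (dt_ext I I_open _ _ E t x Ht) as H.
  rewrite (dt_add I) in H by smoothness. unfold fadd in H.
  rewrite !(dt_mul I) in H by smoothness. unfold fadd, fmul in H.
  rewrite !dt_dx in H by smoothness. unfold fmul in H.
  rewrite !dx_ds in H by smoothness. rewrite ds_cx, ds_cy, ds_dt_cx, ds_dt_cy in H by smoothness.
  pose proof (tangent_unit t x Ht) as U.
  apply Rmult_eq_reg_l with (2 * w t x); [|lra].
  transitivity (dt w t x * w t x + w t x * dt w t x); [ring|]. rewrite H.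
  transitivity (2 * (w t x * w t x) * ((ds phi t x - k t x * V t x)
     * (ta t x * ta t x + tb t x * tb t x))); [ring|]. rewrite U. ring.
Qed.

Lemma dt_ds f : circle_smooth I f ->
  eqI I (dt (ds f))
    (fun t x => ds (dt f) t x - (ds phi t x - k t x * V t x) * ds f t x).
Proof.
  intros Hf t x Ht. pose proof (w_pos t x Ht) as Hw.
  assert (E : eqI I (dx f) (fmul w (ds f))) by (intros s y Hs; apply dx_ds, Hs).
  pose proof (dt_ext I I_open _ _ E t x Ht) as H.
  rewrite (dt_mul I) in H by smoothness.
  rewrite dt_dx in H by smoothness. unfold fadd, fmul in H. rewrite dt_w in H by smoothness.
  apply Rmult_eq_reg_l with (w t x); [|lra]. lra.
Qed.

Lemma circle_smooth_Dn f : circle_smooth I f -> circle_smooth I (normal_dt f).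
Proof.
  intro Hf.
  apply (circle_smooth_ext I I_open (fadd (dt f) (fmul (fconst (-1)) (fmul phi (ds f))))).
  - intros t x _; unfold fadd, fmul, fconst, normal_dt; ring.
  - smoothness.
Qed.
#[local] Hint Resolve circle_smooth_Dn : smoothness.

Lemma Dn_ext f g : eqI I f g -> eqI I (normal_dt f) (normal_dt g).
Proof.
  intros H t x Ht; unfold normal_dt.
  rewrite (dt_ext I I_open f g H t x Ht), (ds_ext f g H t x Ht). reflexivity.
Qed.

Lemma Dn_add f g t x : circle_smooth I f -> circle_smooth I g -> I t ->
  normal_dt (fadd f g) t x = normal_dt f t x + normal_dt g t x.
Proof.
  intros Hf Hg Ht; unfold normal_dt.
  rewrite (dt_add I f g Hf Hg t x Ht), ds_add by smoothness. unfold fadd. ring.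
Qed.

Lemma Dn_mul f g t x : circle_smooth I f -> circle_smooth I g -> I t ->
  normal_dt (fmul f g) t x = normal_dt f t x * g t x + f t x * normal_dt g t x.
Proof.
  intros Hf Hg Ht; unfold normal_dt.
  rewrite (dt_mul I f g Hf Hg t x Ht), ds_mul by smoothness. unfold fadd, fmul. ring.
Qed.

Lemma Dn_const c t x : normal_dt (fconst c) t x = 0.
Proof.
  unfold normal_dt. rewrite ds_const. replace (dt (fconst c) t x) with 0; [ring|].
  symmetry; exact (Derive_const c t).
Qed.

(** Commutator of normal time derivative and arclength derivative: the length
    element shrinks at the rate [k V]. *)
Lemma Dn_ds f : circle_smooth I f ->
  eqI I (normal_dt (ds f)) (fadd (ds (normal_dt f)) (fmul (fmul k V) (ds f))).
Proof.
  intros Hf t x Ht. unfold normal_dt at 1. rewrite dt_ds by smoothness.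
  assert (E : eqI I (normal_dt f) (fadd (dt f) (fmul (fconst (-1)) (fmul phi (ds f))))).
  { intros s y _; unfold fadd, fmul, fconst, normal_dt; ring. }
  unfold fadd, fmul at 1 2. rewrite (ds_ext _ _ E t x Ht).
  pose proof circle_smooth_phi; pose proof (circle_smooth_ds f Hf).
  rewrite ds_add, ds_scal, ds_mul by smoothness.
  ring.
Qed.

Lemma Dn_ta : eqI I (normal_dt ta) (fmul (fconst (-1)) (fmul (ds V) tb)).
Proof.
  intros t x Ht.
  unfold normal_dt. change (dt ta) with (dt (ds cx)).
  rewrite (dt_ds cx cx_smooth t x Ht), ds_dt_cx by smoothness. simpl.
  change (ds cx t x) with (ta t x). rewrite ds_ta by smoothness.
  unfold fmul, fconst. ring.
Qed.

Lemma Dn_tb : eqI I (normal_dt tb) (fmul (ds V) ta).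
Proof.
  intros t x Ht.
  unfold normal_dt. change (dt tb) with (dt (ds cy)).
  rewrite (dt_ds cy cy_smooth t x Ht), ds_dt_cy by smoothness. simpl.
  change (ds cy t x) with (tb t x). rewrite ds_tb by smoothness.
  unfold fmul, fconst. ring.
Qed.

Lemma Dn_k : eqI I (normal_dt k) (fadd (ds (ds V)) (fmul (fmul k k) V)).
Proof.
  intros t x Ht.
  assert (E : eqI I k (fadd (fmul (fmul (fconst (-1)) (ds ta)) tb) (fmul (ds tb) ta))).
  { intros s y _; rewrite k_eq; unfold fadd, fmul, fconst; ring. }
  pose proof circle_smooth_V as GV; pose proof circle_smooth_ta as Ga;
  pose proof circle_smooth_tb as Gb;
  pose proof circle_smooth_k as Gk.
  pose proof (circle_smooth_ds _ GV); pose proof (circle_smooth_ds _ Ga); pose proof (circle_smooth_ds _ Gb).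
  rewrite (Dn_ext _ _ E t x Ht).
  rewrite Dn_add, !Dn_mul, Dn_const by smoothness.
  rewrite Dn_ta, Dn_tb, (Dn_ds ta Ga t x Ht), (Dn_ds tb Gb t x Ht) by smoothness.
  unfold fadd. rewrite (ds_ext _ _ Dn_ta t x Ht), (ds_ext _ _ Dn_tb t x Ht).
  rewrite ds_scal, !ds_mul by smoothness.
  unfold fmul. rewrite ds_ta, ds_tb by smoothness. unfold fmul, fconst.
  pose proof (tangent_unit t x Ht) as U.
  transitivity ((ds (ds V) t x + k t x * k t x * V t x)
      * (ta t x * ta t x + tb t x * tb t x)); [ring|rewrite U; ring].
Qed.

End Geometry.

#[export] Hint Resolve circle_smooth_ds circle_smooth_w circle_smooth_ta circle_smooth_tb
  circle_smooth_k circle_smooth_V circle_smooth_phi circle_smooth_Dn : smoothness.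

(** * Integration along the curves *)

Lemma RInt_nonneg (h : R -> R) a b : a <= b -> (forall x, continuous h x) ->
  (forall x, 0 <= h x) -> 0 <= RInt h a b.
Proof.
  intros Hab Hc Hp. apply RInt_ge_0; auto.
  apply (ex_RInt_continuous h); auto.
Qed.

(** The bound is the integral over the whole period, whatever [x] and [y], so
    that on the circle no shorter arc has to be chosen. *)
Lemma oscillation_le (F f h : R -> R) x y :
  (forall z, is_derive F z (f z)) -> (forall z, continuous f z) ->
  (forall z, continuous h z) -> (forall z, Rabs (f z) <= h z) ->
  0 <= x <= 1 -> 0 <= y <= 1 -> Rabs (F x - F y) <= RInt h 0 1.
Proof.
  intros HF Hf Hh Hle.
  assert (Hp : forall z, 0 <= h z).
  { intro z. eapply Rle_trans; [apply Rabs_pos | apply Hle]. }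
  assert (E : forall u : R -> R, (forall z, continuous u z) -> forall a b, ex_RInt u a b).
  { intros u Hu a b; apply (ex_RInt_continuous u); auto. }
  assert (H : forall a b, 0 <= a <= 1 -> 0 <= b <= 1 -> a <= b ->
            Rabs (F b - F a) <= RInt h 0 1).
  { intros a b Ha Hb Hab.
    assert (I1 : RInt f a b = F b - F a).
    { apply is_RInt_unique. apply (is_RInt_derive F f); auto. }
    assert (I2 : RInt h a b <= RInt h 0 1).
    { pose proof (RInt_Chasles h 0 a b (E h Hh _ _) (E h Hh _ _)) as C1.
      pose proof (RInt_Chasles h 0 b 1 (E h Hh _ _) (E h Hh _ _)) as C2.
      unfold plus in C1, C2; simpl in C1, C2.
      pose proof (RInt_nonneg h 0 a (proj1 Ha) Hh Hp).
      pose proof (RInt_nonneg h b 1 (proj2 Hb) Hh Hp). lra. }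
    rewrite <- I1. apply Rle_trans with (2 := I2).
    apply Rabs_le; split.
    - replace (- RInt h a b) with (RInt (fun x => opp (h x)) a b) by (apply (RInt_opp h); auto).
      apply RInt_le; auto.
      + apply (ex_RInt_continuous (fun x => opp (h x))). intros z _.
        apply (continuous_opp h); auto.
      + intros z _. generalize (Hle z); intro Q; apply Rabs_le_between in Q.
        unfold opp; simpl; lra.
    - apply RInt_le; auto.
      intros z _. generalize (Hle z); intro Q; apply Rabs_le_between in Q. lra. }
  intros Hx Hy. destruct (Rle_dec y x) as [L|L]; [apply H; auto|].
  rewrite Rabs_minus_sym. apply H; auto. lra.
Qed.

Lemma periodic_Z (h : R -> R) : (forall x, h (x + 1) = h x) ->
  forall (z : Z) x, h (x + IZR z) = h x.
Proof.
  intros Hp.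
  assert (N : forall (n : nat) x, h (x + INR n) = h x).
  { induction n as [|n IH]; intro x; [simpl; f_equal; ring|].
    rewrite S_INR, <- Rplus_assoc, Hp. apply IH. }
  intros z x. destruct (Z_le_gt_dec 0 z) as [H|H].
  - rewrite <- (Z2Nat.id z H), <- INR_IZR_INZ. apply N.
  - rewrite <- (N (Z.to_nat (- z)) (x + IZR z)). f_equal.
    rewrite INR_IZR_INZ, Z2Nat.id, opp_IZR by lia. ring.
Qed.

Lemma unit_interval_translate x : exists z : Z, 0 <= x + IZR z <= 1.
Proof.
  exists (1 - up x)%Z. rewrite minus_IZR.
  destruct (archimed x). lra.
Qed.

Section Integrals.

Variable ga : R -> R -> R * R.
Variable I : R -> Prop.
Hypothesis fam : family I ga.

Let I_open := family_open I ga fam.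
Notation J := (arc_integral ga).
Notation ds := (ds ga).
Notation Dn := (normal_dt ga).
Notation w := (w ga).
Notation k := (k ga).
Notation V := (V ga).
Notation phi := (phi ga).

Lemma circle_smooth_continuous f t x : circle_smooth I f -> I t -> continuous (f t) x.
Proof. intros [H _] Ht; apply (smooth2_cont_x I f t x H Ht). Qed.

Lemma J_cont f t x : circle_smooth I f -> I t -> continuous (fun x => f t x * w t x) x.
Proof. intros Hf Ht. apply (circle_smooth_continuous (fmul f w)); smoothness. Qed.

Lemma J_ex f t : circle_smooth I f -> I t -> ex_RInt (fun x => f t x * w t x) 0 1.
Proof.
  intros Hf Ht. apply (ex_RInt_continuous (fun x => f t x * w t x)).
  intros x _; apply J_cont; auto.
Qed.

Lemma J_ext f g t : eqI I f g -> I t -> J f t = J g t.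
Proof. intros H Ht; apply RInt_ext; intros x _; rewrite H by auto; reflexivity. Qed.

Lemma J_add f g t : circle_smooth I f -> circle_smooth I g -> I t -> J (fadd f g) t = J f t + J g t.
Proof.
  intros Hf Hg Ht. unfold arc_integral.
  etransitivity; [|apply (RInt_plus (fun x => f t x * w t x) (fun x => g t x * w t x) 0 1);
                   apply J_ex; auto].
  apply RInt_ext; intros x _. unfold fadd, plus; simpl; ring.
Qed.

Lemma J_scal c f t : circle_smooth I f -> I t -> J (fmul (fconst c) f) t = c * J f t.
Proof.
  intros Hf Ht. unfold arc_integral.
  etransitivity; [|apply (RInt_scal (fun x => f t x * w t x) 0 1); apply J_ex; auto].
  apply RInt_ext; intros x _. unfold fmul, fconst, scal; simpl; unfold mult; simpl; ring.
Qed.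

Lemma J_le f g t : circle_smooth I f -> circle_smooth I g -> I t ->
  (forall x, f t x <= g t x) -> J f t <= J g t.
Proof.
  intros Hf Hg Ht H. apply RInt_le; [lra|apply J_ex; auto|apply J_ex; auto|].
  intros x _. apply Rmult_le_compat_r; [apply Rlt_le, (w_pos ga I fam), Ht | apply H].
Qed.

Lemma J_nonneg f t : circle_smooth I f -> I t -> (forall x, 0 <= f t x) -> 0 <= J f t.
Proof.
  intros Hf Ht H. apply RInt_nonneg; [lra|intro; apply J_cont; auto|].
  intro x. apply Rmult_le_pos; [apply H | apply Rlt_le, (w_pos ga I fam), Ht].
Qed.

Lemma circle_smooth_is_derive f t x : circle_smooth I f -> I t -> is_derive (f t) x (w t x * ds f t x).
Proof.
  intros Hf Ht. rewrite <- (dx_ds ga I fam) by auto.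
  apply (Derive_correct (f t)). apply (smooth2_ex_dx I f); [apply Hf|exact Ht].
Qed.

Lemma J_ds f t : circle_smooth I f -> I t -> J (ds f) t = 0.
Proof.
  intros Hf Ht. unfold arc_integral. apply is_RInt_unique.
  replace 0 with (minus (f t 1) (f t 0)) at 2.
  - apply (is_RInt_derive (f t) (fun x => ds f t x * w t x)).
    + intros x _. rewrite Rmult_comm. apply circle_smooth_is_derive; auto.
    + intros x _. apply J_cont; smoothness.
  - unfold minus, plus, opp; simpl.
    replace 1 with (0 + 1) by ring. rewrite (proj2 Hf t 0 Ht). ring.
Qed.

Lemma J_ibp f g t : circle_smooth I f -> circle_smooth I g -> I t ->
  J (fmul f (ds g)) t = - J (fmul (ds f) g) t.
Proof.
  intros Hf Hg Ht.
  pose proof (J_ds (fmul f g) t) as H.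
  rewrite (J_ext _ (fadd (fmul (ds f) g) (fmul f (ds g)))) in H; auto.
  - rewrite J_add in H by smoothness. specialize (H ltac:(smoothness) Ht). lra.
  - intros s x Hs. unfold fadd, fmul at 2 3. apply (ds_mul ga I); auto.
Qed.

(** The tangential part of the motion contributes [int (phi f)_s ds], which
    vanishes on a closed curve; the normal part changes the length element by
    [- k V]. *)
Lemma is_derive_J f t : circle_smooth I f -> I t ->
  is_derive (J f) t (J (fadd (Dn f) (fmul (fconst (-1)) (fmul f (fmul k V)))) t).
Proof.
  intros Hf Ht.
  evar_last; [apply (is_derive_integral I I_open (fmul f w)); smoothness|].
  transitivity (J (fadd (fadd (Dn f) (fmul (fconst (-1)) (fmul f (fmul k V))))
                        (ds (fmul phi f))) t).
  - apply RInt_ext. intros x _.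
    rewrite (dt_mul I f w) by smoothness. unfold fadd.
    rewrite (ds_mul ga I) by smoothness. unfold fmul, fconst.
    rewrite (dt_w ga I fam) by smoothness. unfold normal_dt.
    match goal with |- ?a = ?b => change (@eq R a b) end. ring.
  - rewrite J_add, (J_ds (fmul phi f)) by smoothness. ring.
Qed.

Definition sq_norm (f : R -> R -> R) : R -> R := J (fmul f f).
Definition curve_length : R -> R := J (fconst 1).
Notation q := sq_norm.
Notation len := curve_length.

Lemma J_const c t : I t -> J (fconst c) t = c * len t.
Proof.
  intro Ht. unfold curve_length. rewrite <- J_scal by smoothness. apply J_ext; auto.
  intros s z _; unfold fmul, fconst; ring.
Qed.

Lemma len_pos t : I t -> 0 < len t.
Proof.
  intro Ht. unfold curve_length, arc_integral. apply RInt_gt_0; [lra| |].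
  - intros x _; unfold fconst; rewrite Rmult_1_l; apply (w_pos ga I fam), Ht.
  - intros x _. apply J_cont; smoothness.
Qed.

Lemma q_nonneg f t : circle_smooth I f -> I t -> 0 <= q f t.
Proof.
  intros Hf Ht. apply J_nonneg; smoothness. intro x. apply Rle_0_sqr.
Qed.

Lemma J_mul_le f g t d : circle_smooth I f -> circle_smooth I g -> I t -> 0 < d ->
  2 * J (fmul f g) t <= d * q f t + / d * q g t.
Proof.
  intros Hf Hg Ht Hd. unfold sq_norm.
  rewrite <- !J_scal, <- J_add by smoothness. apply J_le; smoothness.
  intro x. unfold fmul, fadd, fconst.
  pose proof (Rle_0_sqr (d * f t x - g t x)) as H. unfold Rsqr in H.
  apply Rmult_le_reg_l with d; [exact Hd|].
  replace (d * (d * (f t x * f t x) + / d * (g t x * g t x))) with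
    (d * d * (f t x * f t x) + (g t x * g t x)) by (field; lra).
  lra.
Qed.

Lemma J_mul_abs_le f g t d : circle_smooth I f -> circle_smooth I g -> I t -> 0 < d ->
  2 * Rabs (J (fmul f g) t) <= d * q f t + / d * q g t.
Proof.
  intros Hf Hg Ht Hd. unfold Rabs; destruct (Rcase_abs (J (fmul f g) t)).
  - assert (E : J (fmul (fmul (fconst (-1)) f) g) t = - J (fmul f g) t).
    { rewrite (J_ext _ (fmul (fconst (-1)) (fmul f g))); auto.
      - rewrite J_scal by smoothness. ring.
      - intros s x _; unfold fmul; ring. }
    rewrite <- E.
    replace (q f t) with (q (fmul (fconst (-1)) f) t).
    + apply J_mul_le; smoothness.
    + apply J_ext; auto. intros s x _; unfold fmul, fconst; ring.
  - apply J_mul_le; smoothness.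
Qed.

Lemma q_add_le f g t : circle_smooth I f -> circle_smooth I g -> I t ->
  q (fadd f g) t <= 2 * q f t + 2 * q g t.
Proof.
  intros Hf Hg Ht. unfold sq_norm.
  rewrite <- !J_scal, <- J_add by smoothness. apply J_le; smoothness.
  intro x. unfold fmul, fadd, fconst.
  pose proof (Rle_0_sqr (f t x - g t x)) as H. unfold Rsqr in H. lra.
Qed.

Lemma circle_smooth_translate f t x : circle_smooth I f -> I t -> exists y, 0 <= y <= 1 /\ f t x = f t y.
Proof.
  intros Hf Ht. destruct (unit_interval_translate x) as [z Hz].
  exists (x + IZR z). split; [exact Hz|].
  symmetry. apply (periodic_Z (f t)). intro y; apply Hf, Ht.
Qed.

Lemma oscillation_J f h t x y : circle_smooth I f -> circle_smooth I h -> I t ->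
  (forall z, Rabs (ds f t z) <= h t z) -> Rabs (f t x - f t y) <= J h t.
Proof.
  intros Hf Hh Ht Hle.
  destruct (circle_smooth_translate f t x Hf Ht) as [x' [Hx ->]].
  destruct (circle_smooth_translate f t y Hf Ht) as [y' [Hy ->]].
  apply (oscillation_le (f t) (fun z => w t z * ds f t z)); auto.
  - intro z; apply circle_smooth_is_derive; auto.
  - intro z. apply (circle_smooth_continuous (fmul w (ds f))); smoothness.
  - intro z; apply J_cont; auto.
  - intro z. pose proof (w_pos ga I fam t z Ht) as Hw.
    rewrite Rabs_mult, (Rabs_pos_eq (w t z)) by lra.
    rewrite Rmult_comm. apply Rmult_le_compat_r; [lra | apply Hle].
Qed.

(** Averaging [f(x)^2 <= f(y)^2 + int 2 |f f_s| ds] over [y], and splitting the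
    product with a free weight [d], to be chosen according to the size of [f_s]. *)
Lemma sup_le f t x d : circle_smooth I f -> I t -> 0 < d ->
  f t x * f t x <= / len t * q f t + d * q f t + / d * q (ds f) t.
Proof.
  intros Hf Ht Hd. pose proof (len_pos t Ht) as HL.
  set (h := fadd (fmul (fconst d) (fmul f f)) (fmul (fconst (/ d)) (fmul (ds f) (ds f)))).
  assert (Gh : circle_smooth I h) by (unfold h; smoothness).
  assert (Jh : J h t = d * q f t + / d * q (ds f) t).
  { unfold h, sq_norm. rewrite J_add, !J_scal by smoothness. reflexivity. }
  assert (O : forall y, f t x * f t x <= f t y * f t y + J h t).
  { intro y.
    assert (A : Rabs (fmul f f t x - fmul f f t y) <= J h t).
    { apply oscillation_J; smoothness. intro z.
      rewrite (ds_mul ga I) by smoothness.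
      unfold h, fadd, fmul, fconst. set (a := f t z). set (b := ds f t z).
      apply Rmult_le_reg_l with d; [exact Hd|].
      replace (d * (d * (a * a) + / d * (b * b))) with (d * d * (a * a) + b * b)
        by (field; lra).
      pose proof (Rle_0_sqr (d * a - b)) as S1. pose proof (Rle_0_sqr (d * a + b)) as S2.
      unfold Rsqr in S1, S2.
      unfold Rabs; destruct (Rcase_abs (b * a + a * b)); lra. }
    apply Rabs_le_between in A. unfold fmul in A. lra. }
  assert (B : J (fconst (f t x * f t x)) t <= J (fadd (fmul f f) (fconst (J h t))) t).
  { apply J_le; smoothness. }
  rewrite J_add, !J_const in B by smoothness. fold (q f) in B.
  apply Rmult_le_reg_r with (len t); [exact HL|].
  rewrite Jh in B.
  replace ((/ len t * q f t + d * q f t + / d * q (ds f) t) * len t)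
    with (q f t + (d * q f t + / d * q (ds f) t) * len t) by (field; lra).
  exact B.
Qed.

Fixpoint dsk (j : nat) : R -> R -> R :=
  match j with O => k | S j' => ds (dsk j') end.

Lemma circle_smooth_dsk j : circle_smooth I (dsk j).
Proof. induction j; simpl; smoothness. Qed.
#[local] Hint Resolve circle_smooth_dsk : smoothness.

(** First variation of the elastic energy, for an arbitrary variation: it serves
    for the dissipation along the flow and for the criticality of the limit. *)
Lemma first_variation mu t : I t ->
  is_derive (J (fadd (fmul k k) (fconst mu))) t
   (J (fmul (fadd (fmul (fconst 2) (dsk 2))
             (fadd (fmul k (fmul k k)) (fmul (fconst (- mu)) k))) V) t).
Proof.
  intro Ht. evar_last; [apply is_derive_J; smoothness|].
  transitivity (J (fadd (fmul (fmul (fconst 2) k) (ds (ds V)))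
    (fmul (fadd (fmul k (fmul k k)) (fmul (fconst (- mu)) k)) V)) t).
  - apply J_ext; auto. intros s x Hs. unfold fadd at 1.
    rewrite (Dn_add ga I), (Dn_mul ga I), (Dn_const ga), (Dn_k ga I fam) by smoothness.
    unfold fadd, fmul, fconst. ring.
  - rewrite J_add by smoothness.
    rewrite J_ibp by smoothness.
    assert (E : J (fmul (ds (fmul (fconst 2) k)) (ds V)) t = - J (fmul (fmul (fconst 2) (dsk 2)) V) t).
    { rewrite J_ibp by smoothness. f_equal. apply J_ext; auto.
      assert (E1 : eqI I (ds (fmul (fconst 2) k)) (fmul (fconst 2) (ds k))).
      { intros s x Hs. apply (ds_scal ga I fam); smoothness. }
      intros s x Hs. unfold fmul at 1 3. f_equal.
      rewrite (ds_ext ga I _ _ E1 s x Hs).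
      apply (ds_scal ga I fam); smoothness. }
    rewrite E, Ropp_involutive, <- J_add by smoothness.
    apply J_ext; auto. intros s x _. unfold fadd, fmul; ring.
Qed.

End Integrals.

(** * Curvature bounds along the flow *)

(** Discrete maximum principle.  Convexity from [0] up to [i] places [b i] below
    the chord from [b 0] to [b (i + 1)], and the bound then propagates downwards
    from [b m]. *)
Lemma convex_le (b : nat -> R) (C : R) (m : nat) :
  (forall i, (i + 2 <= m)%nat -> 2 * b (S i) <= b i + b (S (S i))) ->
  b O <= C -> b m <= C -> forall i, (i <= m)%nat -> b i <= C.
Proof.
  intros Hc H0 Hm.
  assert (S1 : forall i, (i + 1 <= m)%nat -> INR (S i) * b i <= b O + INR i * b (S i)).
  { induction i as [|i IH]; intro Hi; [simpl; lra|].
    specialize (IH ltac:(lia)). specialize (Hc i ltac:(lia)).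
    rewrite !S_INR in *. pose proof (pos_INR i) as P.
    assert ((INR i + 1) * (2 * b (S i)) <= (INR i + 1) * (b i + b (S (S i))))
      by (apply Rmult_le_compat_l; lra). lra. }
  assert (S2 : forall n, (n <= m)%nat -> b (m - n)%nat <= C).
  { induction n as [|n IH]; intro Hn; [rewrite Nat.sub_0_r; exact Hm|].
    specialize (IH ltac:(lia)).
    specialize (S1 (m - S n)%nat ltac:(lia)).
    replace (S (m - S n)) with (m - n)%nat in S1 by lia.
    set (i := (m - S n)%nat) in *. replace (m - n)%nat with (S i) in S1, IH by lia.
    rewrite S_INR in S1. pose proof (pos_INR i) as P.
    assert (INR i * b (S i) <= INR i * C) by (apply Rmult_le_compat_l; lra).
    apply Rmult_le_reg_l with (INR i + 1); lra. }
  intros i Hi. replace i with (m - (m - i))%nat by lia. apply S2; lia.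
Qed.

(** Gronwall: [exp t * (F t - M)] decreases for [M] the maximum of [F 1] and [K]. *)
Lemma decay_bound (F D : R -> R) (K : R) :
  (forall t, 1 <= t -> is_derive F t (D t)) ->
  (forall t, 1 <= t -> D t + F t <= K) ->
  forall t, 1 <= t -> F t <= Rmax (F 1) K.
Proof.
  intros HD HK t Ht. set (M := Rmax (F 1) K).
  assert (M1 : F 1 <= M) by apply Rmax_l. assert (M2 : K <= M) by apply Rmax_r.
  destruct (MVT_gen (fun s => exp s * (F s - M)) 1 t
             (fun s => exp s * (F s - M) + exp s * D s)) as [c [Hc E]].
  - intros s Hs. rewrite Rmin_left, Rmax_right in Hs by lra.
    pose proof (HD s ltac:(lra)) as Hd. pose proof (is_derive_unique _ _ _ Hd) as U.
    auto_derive; [exists (D s); exact Hd|]. change (fun x => F x) with F. rewrite U. ring.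
  - intros s Hs. rewrite Rmin_left, Rmax_right in Hs by lra.
    pose proof (HD s ltac:(lra)) as Hd.
    apply continuity_pt_filterlim, (ex_derive_continuous (fun s => exp s * (F s - M))).
    auto_derive. exists (D s); exact Hd.
  - rewrite Rmin_left, Rmax_right in Hc by lra.
    pose proof (HK c ltac:(lra)) as H1.
    pose proof (exp_pos c) as P1. pose proof (exp_pos t) as P2. pose proof (exp_pos 1) as P3.
    assert (A1 : exp c * (F c - M + D c) <= 0) by nra.
    assert (A2 : exp 1 * (F 1 - M) <= 0) by nra.
    assert (A3 : exp t * (F t - M) <= 0) by nra.
    nra.
Qed.

Section FlowEstimates.

Variable ga : R -> R -> R * R.
Variable mu : R.
Hypothesis mu_pos : 0 < mu.
Definition positive_time (t : R) : Prop := 0 < t.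
Notation I := positive_time.
Hypothesis fam : family I ga.
Notation J := (arc_integral ga).
Notation ds := (ds ga).
Notation Dn := (normal_dt ga).
Notation w := (w ga).
Notation k := (k ga).
Notation V := (V ga).
Notation ta := (ta ga).
Notation tb := (tb ga).
Notation cx := (cx ga).
Notation cy := (cy ga).
Notation dsk := (dsk ga).
Notation q := (sq_norm ga).
Notation len := (curve_length ga).
Hypothesis flow : eqI I V (fadd (fmul (fconst (-2)) (dsk 2))
   (fadd (fmul (fconst (-1)) (fmul k (fmul k k))) (fmul (fconst mu) k))).

Let I_open := family_open I ga fam.
Lemma positive_time_ge1 t : 1 <= t -> I t.
Proof. unfold positive_time; lra. Qed.
Hint Resolve positive_time_ge1 : smoothness.
Let cx_smooth : circle_smooth I cx := family_fst I ga fam.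
Let cy_smooth : circle_smooth I cy := family_snd I ga fam.
#[local] Hint Resolve circle_smooth_dsk : smoothness.

Definition energy : R -> R := J (fadd (fmul k k) (fconst mu)).

Lemma energy_derive t : I t -> is_derive energy t (- q V t).
Proof.
  intro Ht. evar_last; [apply (first_variation ga I fam mu t Ht)|].
  transitivity (J (fmul (fconst (-1)) (fmul V V)) t).
  - apply (J_ext ga I); auto. intros s x Hs.
    pose proof (flow s x Hs) as F. unfold fadd, fmul, fconst in *.
    match goal with |- ?a * _ = _ => replace a with (- V s x) by lra end. ring.
  - rewrite (J_scal ga I fam) by smoothness. unfold sq_norm. ring.
Qed.

Lemma energy_decr s t : 0 < s -> s <= t -> energy t <= energy s.
Proof.
  intros Hs Hst.
  destruct (MVT_gen energy s t (fun r => - q V r)) as [c [Hc E]].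
  - intros r Hr. rewrite Rmin_left, Rmax_right in Hr by lra.
    apply energy_derive. unfold positive_time; lra.
  - intros r Hr. rewrite Rmin_left, Rmax_right in Hr by lra.
    apply continuity_pt_filterlim, (ex_derive_continuous energy).
    eexists. apply energy_derive. unfold positive_time; lra.
  - rewrite Rmin_left, Rmax_right in Hc by lra.
    assert (Ic : I c) by (unfold positive_time; lra).
    pose proof (q_nonneg ga I fam V c ltac:(smoothness) Ic). nra.
Qed.

Lemma energy_eq t : I t -> energy t = q k t + mu * len t.
Proof.
  intro Ht. unfold energy. rewrite (J_add ga I fam) by smoothness. f_equal.
  apply (J_const ga I fam), Ht.
Qed.

(** All bounds start at time [1], since smoothness up to the initial instant is
    limited by the regularity of the initial curve. *)
Definition E0 : R := energy 1.

Lemma E0_pos : 0 < E0.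
Proof.
  assert (H : I 1) by (unfold positive_time; lra).
  unfold E0. rewrite energy_eq by exact H.
  pose proof (q_nonneg ga I fam k 1 ltac:(smoothness) H).
  pose proof (len_pos ga I fam 1 H). nra.
Qed.

Lemma q_k_le t : 1 <= t -> q k t <= E0.
Proof.
  intro Ht. pose proof (energy_decr 1 t ltac:(lra) Ht) as H.
  rewrite (energy_eq t) in H by smoothness. fold E0 in H.
  pose proof (len_pos ga I fam t ltac:(smoothness)). nra.
Qed.

Lemma len_le t : 1 <= t -> len t <= E0 / mu.
Proof.
  intro Ht. pose proof (energy_decr 1 t ltac:(lra) Ht) as H.
  rewrite (energy_eq t) in H by smoothness. fold E0 in H.
  pose proof (q_nonneg ga I fam k t ltac:(smoothness) ltac:(smoothness)).
  apply Rmult_le_reg_r with mu; [lra|].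
  replace (E0 / mu * mu) with E0 by (field; lra). lra.
Qed.

Lemma tangent_bound t x : I t -> Rabs (ta t x) <= 1 /\ Rabs (tb t x) <= 1.
Proof.
  intro Ht. pose proof (tangent_unit ga I fam t x Ht) as U.
  split; apply Rabs_le; split; nra.
Qed.

(** Lower bound on the length, a weak form of Fenchel's theorem.  Integrating
    [1 = <tau, gamma_s>] by parts gives [len = - int k <nu, gamma - gamma(0)> ds],
    and [gamma - gamma(0)] is at most [len]; hence the total curvature is at
    least of order one, while by Cauchy-Schwarz its square is at most
    [len * E0]. *)
Lemma len_ge t : 1 <= t -> / (2 * E0) <= len t.
Proof.
  intro Ht. assert (It : I t) by smoothness.
  pose proof (len_pos ga I fam t It) as Lp. pose proof E0_pos as Ep.
  set (L := len t) in *.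
  set (F := fadd cx (fconst (- cx t 0))). set (G := fadd cy (fconst (- cy t 0))).
  set (H := fadd (fmul tb F) (fmul (fconst (-1)) (fmul ta G))).
  assert (GF : circle_smooth I F) by (unfold F; smoothness).
  assert (GG : circle_smooth I G) by (unfold G; smoothness).
  assert (GH : circle_smooth I H) by (unfold H; smoothness).
  assert (BF : forall x, Rabs (F t x) <= L).
  { intro x. unfold F, fadd, fconst.
    apply (oscillation_J ga I fam cx (fconst 1) t x 0); smoothness.
    intro z. unfold fconst. apply tangent_bound, It. }
  assert (BG : forall x, Rabs (G t x) <= L).
  { intro x. unfold G, fadd, fconst.
    apply (oscillation_J ga I fam cy (fconst 1) t x 0); smoothness.
    intro z. unfold fconst. apply tangent_bound, It. }
  assert (dF : eqI I (ds F) ta).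
  { intros s x Hs. unfold F. rewrite (ds_add ga I) by smoothness.
    rewrite ds_const, ds_cx. ring. }
  assert (dG : eqI I (ds G) tb).
  { intros s x Hs. unfold G. rewrite (ds_add ga I) by smoothness.
    rewrite ds_const, ds_cy. ring. }
  assert (E1 : L = J (fmul k H) t).
  { transitivity (J (fadd (fmul ta (ds F)) (fmul tb (ds G))) t).
    - apply (J_ext ga I); auto. intros s x Hs. unfold fadd, fmul, fconst.
      rewrite dF, dG by auto. symmetry; apply (tangent_unit ga I fam), Hs.
    - rewrite (J_add ga I fam), !(J_ibp ga I fam) by smoothness.
      transitivity (- J (fadd (fmul (ds ta) F) (fmul (ds tb) G)) t).
      + rewrite (J_add ga I fam) by smoothness. ring.
      + transitivity (-1 * J (fadd (fmul (ds ta) F) (fmul (ds tb) G)) t); [ring|].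
        rewrite <- (J_scal ga I fam) by smoothness.
        apply (J_ext ga I); auto. intros s x Hs. unfold H, fadd, fmul, fconst.
        rewrite (ds_ta ga I fam), (ds_tb ga I fam) by auto. unfold fmul, fconst. ring. }
  assert (E2 : q H t <= 2 * (L * L) * L).
  { apply Rle_trans with (J (fconst (2 * (L * L))) t).
    - apply (J_le ga I fam); smoothness. intro x. unfold fmul, fconst.
      pose proof (tangent_unit ga I fam t x It) as U.
      assert (F t x * F t x <= L * L).
      { pose proof (BF x) as B. apply Rabs_le_between in B. nra. }
      assert (G t x * G t x <= L * L).
      { pose proof (BG x) as B. apply Rabs_le_between in B. nra. }
      unfold H, fadd, fmul, fconst.
      set (a := ta t x) in *; set (b := tb t x) in *; set (f := F t x) in *;
        set (g := G t x) in *.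
      pose proof (Rle_0_sqr (a * f + b * g)) as S. unfold Rsqr in S.
      assert (Q : (b * f + -1 * (a * g)) * (b * f + -1 * (a * g))
              + (a * f + b * g) * (a * f + b * g) = (a * a + b * b) * (f * f + g * g)) by ring.
      rewrite U in Q. lra.
    - apply Req_le. apply (J_const ga I fam), It. }
  pose proof (q_k_le t Ht) as Hk.
  (* this weight turns [int k^2 <= E0] into exactly half of the left-hand side *)
  assert (dpos : 0 < L / E0) by (apply Rdiv_lt_0_compat; lra).
  pose proof (J_mul_le ga I fam k H t (L / E0) ltac:(smoothness) GH It dpos) as A.
  rewrite <- E1 in A.
  assert (A1 : L / E0 * q k t <= L).
  { apply Rle_trans with (L / E0 * E0); [apply Rmult_le_compat_l; lra|].
    apply Req_le; field; lra. }
  assert (A2 : / (L / E0) * q H t <= 2 * E0 * (L * L)).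
  { apply Rle_trans with (/ (L / E0) * (2 * (L * L) * L)).
    - apply Rmult_le_compat_l; [apply Rlt_le, Rinv_0_lt_compat, dpos | exact E2].
    - apply Req_le; field; lra. }
  apply Rmult_le_reg_l with (2 * E0 * L); [nra|].
  replace (2 * E0 * L * / (2 * E0)) with L by (field; lra). lra.
Qed.

Lemma inv_len_le t : 1 <= t -> / len t <= 2 * E0.
Proof.
  intro Ht. pose proof E0_pos as Ep. rewrite <- (Rinv_inv (2 * E0)).
  apply Rinv_le_contravar; [|exact (len_ge t Ht)].
  apply Rinv_0_lt_compat; lra.
Qed.

(** Interpolation.  Integration by parts and [2 a b <= L^-2 a^2 + L^2 b^2] make the
    rescaled sequence [q (dsk i) / L^(2 i)] convex in [i], so that its end points
    control it. *)
Lemma q_dsk_interpolation m C L t : 1 <= t -> 1 <= L -> q (dsk 0) t <= C ->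
  q (dsk m) t <= C * L ^ (2 * m) -> forall i, (i <= m)%nat -> q (dsk i) t <= C * L ^ (2 * i).
Proof.
  intros Ht HL H0 Hm i Hi. assert (It : I t) by smoothness.
  assert (Lp : forall n, 0 < L ^ n) by (intro n; apply pow_lt; lra).
  set (b := fun i => q (dsk i) t / L ^ (2 * i)).
  assert (B : b i <= C).
  { apply (convex_le b C m); auto.
    - intros n _. unfold b.
      assert (E : q (dsk (S n)) t = - J (fmul (dsk (S (S n))) (dsk n)) t).
      { unfold sq_norm. change (dsk (S n)) with (ds (dsk n)) at 2.
        apply (J_ibp ga I fam); smoothness. }
      assert (P2 : 0 < / (L * L)) by (apply Rinv_0_lt_compat; nra).
      pose proof (J_mul_abs_le ga I fam (dsk (S (S n))) (dsk n) t (/ (L * L))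
        ltac:(smoothness) ltac:(smoothness) It P2) as A.
      rewrite Rinv_inv in A.
      assert (A' : 2 * q (dsk (S n)) t <=
        / (L * L) * q (dsk (S (S n))) t + L * L * q (dsk n) t).
      { pose proof (Rle_abs (- J (fmul (dsk (S (S n))) (dsk n)) t)) as R1.
        rewrite Rabs_Ropp in R1. lra. }
      replace (2 * S (S n))%nat with (S (S (S (S (2 * n))))) by lia.
      replace (2 * S n)%nat with (S (S (2 * n))) by lia. simpl pow at 1 3.
      specialize (Lp (2 * n)%nat). simpl (2 * n)%nat in *.
      set (p := L ^ (n + (n + 0))) in *.
      apply Rmult_le_reg_l with (L * L * p); [repeat apply Rmult_lt_0_compat; lra|].
      replace (L * L * p * (2 * (q (dsk (S n)) t / (L * (L * p))))) with (2 * q (dsk (S n)) t)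
        by (field; lra).
      replace (L * L * p * (q (dsk n) t / p + q (dsk (S (S n))) t / (L * (L * (L * (L * p))))))
        with (/ (L * L) * q (dsk (S (S n))) t + L * L * q (dsk n) t) by (field; lra).
      exact A'.
    - unfold b; simpl. unfold Rdiv; rewrite Rinv_1, Rmult_1_r. exact H0.
    - unfold b. apply Rmult_le_reg_r with (L ^ (2 * m)); [apply Lp|].
      unfold Rdiv; rewrite Rmult_assoc, Rinv_l, Rmult_1_r; [exact Hm|].
      apply Rgt_not_eq, Lp. }
  unfold b in B. apply Rmult_le_reg_r with (/ L ^ (2 * i)); [apply Rinv_0_lt_compat, Lp|].
  rewrite (Rmult_assoc C), Rinv_r, Rmult_1_r; [exact B|apply Rgt_not_eq, Lp].
Qed.

(** Polynomials in the [dsk i] graded by total number [d] of derivatives and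
    number [l] of factors.  The squares of their sup norms will be estimated by
    [Lam^(2 d + l)] for a scale [Lam], as if every derivative cost a factor [Lam]
    and every factor a further [sqrt Lam].  The constructors [hom_raise] and
    [hom_trade] absorb terms of lower or equal weight [2 d + l] into the leading
    one, so that the terms of different degrees that the flow equation produces
    can be treated as a single homogeneous one. *)
Inductive hom : nat -> nat -> (R -> R -> R) -> Prop :=
| hom_dsk i : hom i 1 (dsk i)
| hom_add d l f g : hom d l f -> hom d l g -> hom d l (fadd f g)
| hom_scal c d l f : hom d l f -> hom d l (fmul (fconst c) f)
| hom_mul d1 l1 d2 l2 f g : hom d1 l1 f -> hom d2 l2 g ->
    hom (d1 + d2) (l1 + l2) (fmul f g)
| hom_raise d l f : hom d l f -> hom (S d) l f
| hom_trade d l f : hom d (S (S (S l))) f -> hom (S d) (S l) f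
| hom_ext d l f g : eqI I f g -> hom d l f -> hom d l g.

Lemma hom_circle_smooth d l f : hom d l f -> circle_smooth I f.
Proof.
  induction 1; try (smoothness; fail).
  apply (circle_smooth_ext I I_open f); auto.
Qed.
#[local] Hint Resolve hom_circle_smooth : smoothness.

Lemma hom_ds d l f : hom d l f -> hom (S d) l (ds f).
Proof.
  induction 1.
  - apply (hom_dsk (S i)).
  - apply (hom_ext _ _ (fadd (ds f) (ds g))); [|apply hom_add; auto].
    intros t x Ht. symmetry. apply (ds_add ga I); eauto using hom_circle_smooth.
  - apply (hom_ext _ _ (fmul (fconst c) (ds f))); [|apply hom_scal; auto].
    intros t x Ht. symmetry. apply (ds_scal ga I fam); eauto using hom_circle_smooth.
  - apply (hom_ext _ _ (fadd (fmul (ds f) g) (fmul f (ds g)))).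
    + intros t x Ht. symmetry. apply (ds_mul ga I); eauto using hom_circle_smooth.
    + apply hom_add.
      * apply (hom_mul (S d1)); auto.
      * replace (S (d1 + d2)) with (d1 + S d2)%nat by lia. apply hom_mul; auto.
  - apply hom_raise; auto.
  - apply hom_trade; auto.
  - apply (hom_ext _ _ (ds f)); auto. apply ds_ext; auto.
Qed.

(** Gagliardo-Nirenberg estimate for all the polynomials at once.  In a product
    one factor is taken in [L^2] and the others in sup norm; the squared [L^2]
    norm is smaller than the squared sup norm by one power of [Lam], which is the
    factor on the left of the second estimate.  The sup norm of a factor requires
    one spare derivative, [d < m]; at most one factor of a product of order at
    most [m] fails this, and that one is put in [L^2]. *)
Lemma hom_bound m C0 (Lam : R -> R) : (1 <= m)%nat -> (forall t, 1 <= t -> 1 <= Lam t) ->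
  (forall i t, (i <= m)%nat -> 1 <= t -> q (dsk i) t <= C0 * Lam t ^ (2 * i)) ->
  0 <= C0 ->
  forall d l f, hom d l f ->
   ((d < m)%nat -> exists C, 0 <= C /\ forall t x, 1 <= t ->
        f t x * f t x <= C * Lam t ^ (2 * d + l)) /\
   ((d <= m)%nat -> exists C, 0 <= C /\ forall t, 1 <= t ->
        Lam t * q f t <= C * Lam t ^ (2 * d + l)).
Proof.
  intros Hm1 HL Hq HC0.
  assert (Lp : forall t n, 1 <= t -> 0 < Lam t ^ n)
    by (intros t n Ht; apply pow_lt; specialize (HL t Ht); lra).
  induction 1 as [i|d l f g Hf IHf Hg IHg|c d l f Hf IHf
     |d1 l1 d2 l2 f g Hf IHf Hg IHg|d l f Hf IHf|d l f Hf IHf|d l f g E Hf IHf].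
  - split; intro Hi.
    + pose proof E0_pos as Ep. exists (2 * E0 * C0 + 2 * C0). split; [nra|].
      intros t x Ht. assert (It : I t) by smoothness.
      specialize (HL t Ht).
      eapply Rle_trans; [apply (sup_le ga I fam (dsk i) t x (Lam t)); smoothness; lra|].
      pose proof (Hq i t ltac:(lia) Ht) as Q1. pose proof (Hq (S i) t Hi Ht) as Q2.
      change (ds (dsk i)) with (dsk (S i)).
      replace (2 * S i)%nat with (S (S (2 * i))) in Q2 by lia. simpl pow in Q2.
      replace (2 * i + 1)%nat with (S (2 * i)) by lia. simpl pow.
      specialize (Lp t (2 * i)%nat Ht). simpl (2 * i)%nat in *.
      set (p := Lam t ^ (i + (i + 0))) in *. set (L := Lam t) in *.
      pose proof (len_pos ga I fam t It) as Hlp.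
      pose proof (inv_len_le t Ht) as Hinv.
      pose proof (q_nonneg ga I fam (dsk i) t ltac:(smoothness) It) as N1.
      assert (T1 : / len t * q (dsk i) t <= 2 * E0 * (C0 * (L * p))).
      { apply Rmult_le_compat; [apply Rlt_le, Rinv_0_lt_compat, Hlp|lra|exact Hinv|].
        apply Rle_trans with (1 := Q1). apply Rmult_le_compat_l; nra. }
      assert (T2 : L * q (dsk i) t <= C0 * (L * p)).
      { replace (C0 * (L * p)) with (L * (C0 * p)) by ring.
        apply Rmult_le_compat_l; lra. }
      assert (T3 : / L * q (dsk (S i)) t <= C0 * (L * p)).
      { apply Rmult_le_reg_l with L; [lra|]. rewrite <- Rmult_assoc, Rinv_r by lra.
        lra. }
      lra.
    + exists C0; split; [exact HC0|]. intros t Ht.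
      replace (2 * i + 1)%nat with (S (2 * i)) by lia. simpl pow.
      specialize (HL t Ht). specialize (Hq i t Hi Ht). simpl (2 * i)%nat in *.
      replace (C0 * (Lam t * Lam t ^ (i + (i + 0))))
        with (Lam t * (C0 * Lam t ^ (i + (i + 0)))) by ring.
      apply Rmult_le_compat_l; lra.
  - destruct IHf as [F1 F2], IHg as [G1 G2]; split; intro Hd.
    + destruct (F1 Hd) as [C1 [P1 B1]], (G1 Hd) as [C2 [P2 B2]].
      exists (2 * C1 + 2 * C2); split; [lra|]. intros t x Ht.
      specialize (B1 t x Ht); specialize (B2 t x Ht). unfold fadd.
      pose proof (Rle_0_sqr (f t x - g t x)) as S1. unfold Rsqr in S1. lra.
    + destruct (F2 Hd) as [C1 [P1 B1]], (G2 Hd) as [C2 [P2 B2]].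
      exists (2 * C1 + 2 * C2); split; [lra|]. intros t Ht.
      specialize (B1 t Ht); specialize (B2 t Ht). specialize (HL t Ht).
      pose proof (q_add_le ga I fam f g t ltac:(eauto with smoothness) ltac:(eauto with smoothness)
        ltac:(smoothness)) as S1. nra.
  - destruct IHf as [F1 F2]; split; intro Hd.
    + destruct (F1 Hd) as [C1 [P1 B1]].
      exists (c * c * C1); split; [pose proof (Rle_0_sqr c); unfold Rsqr in *; nra|].
      intros t x Ht. specialize (B1 t x Ht). unfold fmul, fconst.
      pose proof (Rle_0_sqr c) as S1; unfold Rsqr in S1.
      replace (c * f t x * (c * f t x)) with (c * c * (f t x * f t x)) by ring.
      rewrite (Rmult_assoc (c * c)). apply Rmult_le_compat_l; auto.
    + destruct (F2 Hd) as [C1 [P1 B1]].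
      exists (c * c * C1); split; [pose proof (Rle_0_sqr c); unfold Rsqr in *; nra|].
      intros t Ht. specialize (B1 t Ht).
      pose proof (Rle_0_sqr c) as S1; unfold Rsqr in S1.
      assert (E : q (fmul (fconst c) f) t = c * c * q f t).
      { unfold sq_norm. rewrite <- (J_scal ga I fam) by eauto with smoothness.
        apply (J_ext ga I); [|smoothness]. intros s x _; unfold fmul, fconst; ring. }
      rewrite E. replace (Lam t * (c * c * q f t)) with (c * c * (Lam t * q f t)) by ring.
      rewrite (Rmult_assoc (c * c)). apply Rmult_le_compat_l; auto.
  - destruct IHf as [F1 F2], IHg as [G1 G2].
    assert (Hpow : forall t, Lam t ^ (2 * (d1 + d2) + (l1 + l2)) =
       Lam t ^ (2 * d1 + l1) * Lam t ^ (2 * d2 + l2)).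
    { intro t. rewrite <- pow_add. f_equal; lia. }
    assert (Hmul : forall f g t S, circle_smooth I f -> circle_smooth I g -> 1 <= t ->
        (forall x, g t x * g t x <= S) -> q (fmul f g) t <= S * q f t).
    { intros f' g' t S Hf' Hg' Ht HS. unfold sq_norm.
      rewrite <- (J_scal ga I fam) by smoothness.
      apply (J_le ga I fam); smoothness. intro x. unfold fmul, fconst.
      specialize (HS x). pose proof (Rle_0_sqr (f' t x)) as S1; unfold Rsqr in S1.
      replace (f' t x * g' t x * (f' t x * g' t x)) with
        (g' t x * g' t x * (f' t x * f' t x)) by ring.
      apply Rmult_le_compat_r; auto. }
    split; intro Hd.
    + destruct (F1 ltac:(lia)) as [C1 [P1 B1]], (G1 ltac:(lia)) as [C2 [P2 B2]].
      exists (C1 * C2); split; [nra|]. intros t x Ht.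
      specialize (B1 t x Ht); specialize (B2 t x Ht). unfold fmul.
      rewrite Hpow.
      replace (f t x * g t x * (f t x * g t x)) with
        ((f t x * f t x) * (g t x * g t x)) by ring.
      replace (C1 * C2 * (Lam t ^ (2 * d1 + l1) * Lam t ^ (2 * d2 + l2))) with
        ((C1 * Lam t ^ (2 * d1 + l1)) * (C2 * Lam t ^ (2 * d2 + l2))) by ring.
      apply Rmult_le_compat; auto; apply Rle_0_sqr.
    + (* [1 <= m], so the two factors cannot both be of order [m] *)
      destruct (Nat.lt_ge_cases d2 m) as [L2|L2].
      * destruct (F2 ltac:(lia)) as [C1 [P1 B1]], (G1 L2) as [C2 [P2 B2]].
        exists (C1 * C2); split; [nra|]. intros t Ht. rewrite Hpow.
        pose proof (Hmul f g t _ ltac:(eauto with smoothness) ltac:(eauto with smoothness) Ht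
          (fun x => B2 t x Ht)) as A.
        specialize (B1 t Ht). specialize (HL t Ht).
        replace (C1 * C2 * (Lam t ^ (2 * d1 + l1) * Lam t ^ (2 * d2 + l2))) with
          ((C2 * Lam t ^ (2 * d2 + l2)) * (C1 * Lam t ^ (2 * d1 + l1))) by ring.
        apply Rle_trans with ((C2 * Lam t ^ (2 * d2 + l2)) * (Lam t * q f t)).
        -- replace (C2 * Lam t ^ (2 * d2 + l2) * (Lam t * q f t)) with
             (Lam t * (C2 * Lam t ^ (2 * d2 + l2) * q f t)) by ring.
           apply Rmult_le_compat_l; lra.
        -- apply Rmult_le_compat_l; [|exact B1].
           apply Rmult_le_pos; [exact P2|apply Rlt_le, Lp, Ht].
      * destruct (G2 ltac:(lia)) as [C1 [P1 B1]], (F1 ltac:(lia)) as [C2 [P2 B2]].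
        exists (C1 * C2); split; [nra|]. intros t Ht. rewrite Hpow.
        pose proof (Hmul g f t _ ltac:(eauto with smoothness) ltac:(eauto with smoothness) Ht
          (fun x => B2 t x Ht)) as A.
        assert (Ecomm : q (fmul f g) t = q (fmul g f) t).
        { apply (J_ext ga I); [|smoothness]. intros s x _; unfold fmul; ring. }
        specialize (B1 t Ht). specialize (HL t Ht). rewrite Ecomm.
        replace (C1 * C2 * (Lam t ^ (2 * d1 + l1) * Lam t ^ (2 * d2 + l2))) with
          ((C2 * Lam t ^ (2 * d1 + l1)) * (C1 * Lam t ^ (2 * d2 + l2))) by ring.
        apply Rle_trans with ((C2 * Lam t ^ (2 * d1 + l1)) * (Lam t * q g t)).
        -- replace (C2 * Lam t ^ (2 * d1 + l1) * (Lam t * q g t)) with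
             (Lam t * (C2 * Lam t ^ (2 * d1 + l1) * q g t)) by ring.
           apply Rmult_le_compat_l; lra.
        -- apply Rmult_le_compat_l; [|exact B1].
           apply Rmult_le_pos; [exact P2|apply Rlt_le, Lp, Ht].
  - destruct IHf as [F1 F2].
    assert (Hpow : forall C t, 0 <= C -> 1 <= t ->
       C * Lam t ^ (2 * d + l) <= C * Lam t ^ (2 * S d + l)).
    { intros C t HC Ht. apply Rmult_le_compat_l; [exact HC|].
      apply Rle_pow; [apply HL, Ht|lia]. }
    split; intro Hd.
    + destruct (F1 ltac:(lia)) as [C [P B]]. exists C; split; [exact P|].
      intros t x Ht. eapply Rle_trans; [apply B, Ht|apply Hpow; auto].
    + destruct (F2 ltac:(lia)) as [C [P B]]. exists C; split; [exact P|].
      intros t Ht. eapply Rle_trans; [apply B, Ht|apply Hpow; auto].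
  - destruct IHf as [F1 F2].
    replace (2 * S d + S l)%nat with (2 * d + S (S (S l)))%nat by lia.
    split; intro Hd; [apply F1|apply F2]; lia.
  - destruct IHf as [F1 F2]. split; intro Hd.
    + destruct (F1 Hd) as [C [P B]]. exists C; split; [exact P|].
      intros t x Ht. rewrite <- (E t x) by smoothness. apply B, Ht.
    + destruct (F2 Hd) as [C [P B]]. exists C; split; [exact P|].
      intros t Ht. replace (q g t) with (q f t); [apply B, Ht|].
      apply (J_ext ga I); [|smoothness]. intros s x Hs; unfold fmul; rewrite (E s x Hs); reflexivity.
Qed.

Lemma hom_kV : hom 2 2 (fmul k V).
Proof.
  apply (hom_ext _ _ (fadd (fmul (fconst (-2)) (fmul k (dsk 2)))
    (fadd (fmul (fconst (-1)) (fmul k (fmul k (fmul k k))))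
          (fmul (fconst mu) (fmul k k))))).
  - intros t x Ht. unfold fmul at 9. rewrite (flow t x Ht).
    unfold fadd, fmul, fconst. ring.
  - pose proof (hom_dsk 0) as H0. pose proof (hom_dsk 2) as H2.
    pose proof (hom_mul _ _ _ _ _ _ H0 H0) as H00.
    pose proof (hom_mul _ _ _ _ _ _ H0 (hom_mul _ _ _ _ _ _ H0 H00)) as H0000.
    apply hom_add; [|apply hom_add]; apply hom_scal.
    + apply (hom_mul 0 1 2 1); auto.
    + apply hom_raise, hom_trade, H0000.
    + apply hom_raise, hom_raise, H00.
Qed.

(** Evolution of the derivatives of curvature: a fourth order linear equation up to
    terms that are at least cubic, hence of lower weight. *)
Lemma Dn_dsk j : exists r, hom (2 + j) 3 r /\
  eqI I (Dn (dsk j)) (fadd (fmul (fconst (-2)) (dsk (4 + j)))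
                          (fadd (fmul (fconst mu) (dsk (2 + j))) r)).
Proof.
  pose proof hom_kV as HkV.
  induction j as [|j [r [Hr E]]].
  - set (c := fmul (fconst (-1)) (fmul k (fmul k k))).
    pose proof (hom_dsk 0) as H0.
    assert (Hc : hom 0 3 c).
    { apply hom_scal. exact (hom_mul _ _ _ _ _ _ H0 (hom_mul _ _ _ _ _ _ H0 H0)). }
    assert (Gc : circle_smooth I c) by eauto using hom_circle_smooth.
    exists (fadd (ds (ds c)) (fmul k (fmul k V))). split.
    + apply hom_add; [apply hom_ds, hom_ds, Hc|].
      exact (hom_mul _ _ _ _ _ _ H0 HkV).
    + assert (E1 : eqI I (ds V) (fadd (fmul (fconst (-2)) (dsk 3))
                 (fadd (ds c) (fmul (fconst mu) (dsk 1))))).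
      { intros t x Ht. rewrite (ds_ext ga I _ _ flow t x Ht). fold c.
        unfold fadd at 3 4. rewrite !(ds_add ga I) by smoothness.
        rewrite !(ds_scal ga I fam) by smoothness. reflexivity. }
      intros t x Ht. change (dsk 0) with k.
      rewrite (Dn_k ga I fam t x Ht). unfold fadd at 1.
      rewrite (ds_ext ga I _ _ E1 t x Ht).
      rewrite !(ds_add ga I) by smoothness. rewrite !(ds_scal ga I fam) by smoothness.
      unfold fadd, fmul, fconst. simpl. ring.
  - assert (Gr : circle_smooth I r) by eauto using hom_circle_smooth.
    exists (fadd (ds r) (fmul (fmul k V) (dsk (S j)))). split.
    + apply hom_add; [apply hom_ds, Hr|].
      exact (hom_mul _ _ _ _ _ _ HkV (hom_dsk (S j))).
    + intros t x Ht. change (dsk (S j)) with (ds (dsk j)) at 1.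
      rewrite (Dn_ds ga I fam) by smoothness. unfold fadd at 1.
      rewrite (ds_ext ga I _ _ E t x Ht).
      rewrite !(ds_add ga I) by smoothness. rewrite !(ds_scal ga I fam) by smoothness.
      unfold fadd, fmul, fconst. simpl. ring.
Qed.

Lemma q_dsk_derive j : exists r, hom (2 + j) 3 r /\
  forall t, I t -> exists D : R, is_derive (q (dsk j)) t D /\
    D <= - 4 * q (dsk (2 + j)) t + J (fmul (dsk j) r) t.
Proof.
  destruct (Dn_dsk j) as [r [Hr E]].
  assert (Gr : circle_smooth I r) by eauto using hom_circle_smooth.
  exists (fadd (fmul (fconst 2) r) (fmul (fconst (-1)) (fmul (dsk j) (fmul k V)))).
  split.
  - apply hom_add; apply hom_scal; auto.
    replace (2 + j)%nat with (j + 2)%nat by lia.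
    apply (hom_mul j 1 2 2); [apply hom_dsk | apply hom_kV].
  - intros t Ht. eexists; split; [apply (is_derive_J ga I fam); smoothness|].
    apply Rle_trans with (J (fadd
       (fmul (fconst (-4)) (fmul (dsk j) (ds (dsk (3 + j)))))
       (fadd (fmul (fconst (2 * mu)) (fmul (dsk j) (ds (dsk (1 + j)))))
       (fmul (dsk j) (fadd (fmul (fconst 2) r) (fmul (fconst (-1)) (fmul (dsk j) (fmul k V))))))) t);
      [apply Req_le|].
    + apply (J_ext ga I); auto. intros s x Hs. unfold fadd at 1.
      rewrite (Dn_mul ga I) by smoothness. rewrite E by auto.
      unfold fadd, fmul, fconst. simpl. ring.
    + rewrite !(J_add ga I fam), !(J_scal ga I fam) by smoothness.
      assert (E4 : J (fmul (dsk j) (ds (dsk (3 + j)))) t = q (dsk (2 + j)) t).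
      { rewrite (J_ibp ga I fam) by smoothness.
        change (ds (dsk j)) with (dsk (1 + j)).
        replace (J (fmul (dsk (1 + j)) (dsk (3 + j))) t)
          with (J (fmul (dsk (1 + j)) (ds (dsk (2 + j)))) t) by reflexivity.
        rewrite (J_ibp ga I fam) by smoothness. rewrite Ropp_involutive. reflexivity. }
      assert (E2 : J (fmul (dsk j) (ds (dsk (1 + j)))) t = - q (dsk (1 + j)) t).
      { rewrite (J_ibp ga I fam) by smoothness. reflexivity. }
      rewrite E4, E2.
      pose proof (q_nonneg ga I fam (dsk (1 + j)) t ltac:(smoothness) Ht). nra.
Qed.

(** With [m = j + 2] and [Lam^(2 m) = 1 + q (dsk m)], interpolation bounds all
    [q (dsk i)], [i <= m], by [Lam^(2 i)].  The good term [- 4 q (dsk m)] then has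
    size [Lam^(2 m)], whereas the remaining ones have size at most
    [Lam^(2 m - 1)].  So [(q (dsk j))' + q (dsk j)] is bounded above.  No smoothing
    estimate is involved: the bound starts from the finite value at time [1]. *)
Lemma q_dsk_bounded j : exists C, forall t, 1 <= t -> q (dsk j) t <= C.
Proof.
  set (m := (2 + j)%nat).
  set (Lam := fun t => Rpower (1 + q (dsk m) t) (/ INR (2 * m))).
  assert (Hq0 : forall i t, 1 <= t -> 0 <= q (dsk i) t).
  { intros i t Ht; apply (q_nonneg ga I fam); smoothness. }
  assert (Hmp : 0 < INR (2 * m)) by (apply lt_0_INR; unfold m; lia).
  assert (Lam1 : forall t, 1 <= t -> 1 <= Lam t).
  { intros t Ht. unfold Lam.
    apply Rle_trans with (Rpower 1 (/ INR (2 * m))).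
    - unfold Rpower. rewrite ln_1, Rmult_0_r, exp_0. lra.
    - apply Rle_Rpower_l; [apply Rlt_le, Rinv_0_lt_compat, Hmp|].
      specialize (Hq0 m t Ht). lra. }
  assert (LamE : forall t, 1 <= t -> Lam t ^ (2 * m) = 1 + q (dsk m) t).
  { intros t Ht. specialize (Hq0 m t Ht). specialize (Lam1 t Ht).
    rewrite <- Rpower_pow by lra. unfold Lam.
    rewrite Rpower_mult, Rinv_l, Rpower_1; lra. }
  set (C0 := Rmax 1 E0).
  assert (C0a : 1 <= C0) by apply Rmax_l. assert (C0b : E0 <= C0) by apply Rmax_r.
  assert (Interp : forall i t, (i <= m)%nat -> 1 <= t ->
            q (dsk i) t <= C0 * Lam t ^ (2 * i)).
  { intros i t Hi Ht. apply (q_dsk_interpolation m); auto.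
    - apply Rle_trans with (2 := C0b). apply q_k_le, Ht.
    - rewrite LamE by auto. specialize (Hq0 m t Ht). nra. }
  destruct (q_dsk_derive j) as [r [Hr HD]].
  destruct (proj2 (hom_bound m C0 Lam ltac:(unfold m; lia) Lam1 Interp ltac:(lra)
     _ _ _ Hr) (le_n _)) as [C1 [C1p B]].
  assert (Gr : circle_smooth I r) by eauto using hom_circle_smooth.
  (* with [L = Lam t], derivative plus value is at most [- 4 (L^(2m) - 1) + C2 L^(2m-1)] *)
  set (C2 := 2 * C0 + C1). set (K := 4 + C2 ^ (4 + 2 * j)).
  destruct (functional_choice (fun (t D : R) => 1 <= t -> is_derive (q (dsk j)) t D /\
    D <= - 4 * q (dsk (2 + j)) t + J (fmul (dsk j) r) t)) as [D HDD].
  { intro t. destruct (Rle_dec 1 t) as [Ht|Ht].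
    - destruct (HD t ltac:(smoothness)) as [d Hd]. exists d; auto.
    - exists 0; intro; contradiction. }
  exists (Rmax (q (dsk j) 1) K).
  apply (decay_bound _ D); [intros t Ht; apply HDD, Ht|].
  intros t Ht. destruct (HDD t Ht) as [_ Hle].
  assert (It : I t) by smoothness.
  pose proof (Lam1 t Ht) as HL. pose proof (LamE t Ht) as HE.
  pose proof (Interp j t ltac:(unfold m; lia) Ht) as HI. specialize (B t Ht).
  fold m in Hle. set (L := Lam t) in *.
  assert (L3 : 0 < L * L * L) by (repeat apply Rmult_lt_0_compat; lra).
  pose proof (J_mul_le ga I fam (dsk j) r t (L * L * L) ltac:(smoothness) Gr It L3) as A.
  replace (2 * m)%nat with (S (S (S (S (2 * j))))) in HE by (unfold m; lia).
  replace (2 * (2 + j) + 3)%nat with (S (S (S (S (S (S (S (2 * j)))))))) in B by lia.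
  simpl pow in B, HE.
  assert (Lp : 1 <= L ^ (2 * j)) by (apply pow_R1_Rle; lra).
  unfold K. replace (4 + 2 * j)%nat with (S (S (S (S (2 * j))))) by lia.
  assert (HCL : C2 * (L * L * L * L ^ (2 * j)) <=
     L * L * L * L * L ^ (2 * j) + C2 ^ (S (S (S (S (2 * j)))))).
  { assert (C2p : 0 <= C2) by (unfold C2; lra).
    destruct (Rle_dec C2 L) as [HC|HC].
    - assert (0 <= C2 ^ (S (S (S (S (2 * j)))))) by (apply pow_le; lra).
      assert (C2 * (L * L * L * L ^ (2 * j)) <= L * (L * L * L * L ^ (2 * j)))
        by (apply Rmult_le_compat_r; nra). lra.
    - assert (P : L ^ (S (S (S (2 * j)))) <= C2 ^ (S (S (S (2 * j)))))
        by (apply pow_incr; lra).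
      rewrite <- (tech_pow_Rmult C2 (S (S (S (2 * j))))).
      assert (C2 * L ^ (S (S (S (2 * j)))) <= C2 * C2 ^ (S (S (S (2 * j)))))
        by (apply Rmult_le_compat_l; lra).
      assert (Q : L ^ (S (S (S (2 * j)))) = L * L * L * L ^ (2 * j)) by (simpl; ring).
      rewrite Q in *.
      assert (0 <= L * L * L * L * L ^ (2 * j)) by (repeat apply Rmult_le_pos; lra).
      lra. }
  simpl (2 * j)%nat in *. set (p := L ^ (j + (j + 0))) in *.
  set (a := q (dsk j) t) in *. set (b := q (dsk m) t) in *. set (rr := q r t) in *.
  assert (A1 : L * L * L * a <= C0 * (L * L * L * p)).
  { replace (C0 * (L * L * L * p)) with (L * L * L * (C0 * p)) by ring.
    apply Rmult_le_compat_l; lra. }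
  assert (A2 : / (L * L * L) * rr <= C1 * (L * L * L * p)).
  { apply Rmult_le_reg_l with (L * (L * L * L)); [repeat apply Rmult_lt_0_compat; lra|].
    replace (L * (L * L * L) * (/ (L * L * L) * rr)) with (L * rr) by (field; lra).
    replace (L * (L * L * L) * (C1 * (L * L * L * p))) with
      (C1 * (L * (L * (L * (L * (L * (L * (L * p)))))))) by ring. exact B. }
  assert (A3 : a <= C0 * (L * L * L * p)).
  { apply Rle_trans with (L * L * L * a); [|exact A1].
    assert (0 <= a) by (apply Hq0, Ht). assert (1 <= L * L) by nra.
    assert (1 <= L * L * L) by nra. nra. }
  unfold C2 in HCL at 1.
  assert (X0 : 0 <= L * L * L * p) by (apply Rmult_le_pos; lra).
  assert (X1 : 0 <= L * (L * L * L * p)) by (apply Rmult_le_pos; lra).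
  set (X := L * L * L * p) in *.
  assert (0 <= C0 * X) by (apply Rmult_le_pos; lra).
  assert (0 <= C1 * X) by (apply Rmult_le_pos; lra).
  replace (L * L * L * L * p) with (L * X) in HCL by (unfold X; ring).
  replace (L * (L * (L * (L * p)))) with (L * X) in HE by (unfold X; ring).
  lra.
Qed.

Lemma dsk_bounded j : exists C, 0 <= C /\ forall t x, 1 <= t -> Rabs (dsk j t x) <= C.
Proof.
  destruct (q_dsk_bounded j) as [C1 B1]. destruct (q_dsk_bounded (S j)) as [C2 B2].
  set (C := 2 * E0 * C1 + C1 + C2).
  exists (1 + C). pose proof E0_pos as Ep.
  assert (N : forall i, 0 <= q (dsk i) 1).
  { intro i; apply (q_nonneg ga I fam); smoothness. apply positive_time_ge1; lra. }
  pose proof (N j) as Nj. pose proof (N (S j)) as NSj.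
  pose proof (B1 1 (Rle_refl 1)). pose proof (B2 1 (Rle_refl 1)).
  assert (0 <= C) by (unfold C; nra).
  split; [lra|]. intros t x Ht. assert (It : I t) by smoothness.
  pose proof (sup_le ga I fam (dsk j) t x 1 ltac:(smoothness) It Rlt_0_1) as S1.
  change (ds (dsk j)) with (dsk (S j)) in S1.
  specialize (B1 t Ht); specialize (B2 t Ht).
  pose proof (len_pos ga I fam t It) as Hlp.
  pose proof (inv_len_le t Ht) as Hinv.
  pose proof (q_nonneg ga I fam (dsk j) t ltac:(smoothness) It) as N1.
  assert (T1 : / len t * q (dsk j) t <= 2 * E0 * C1).
  { apply Rmult_le_compat; auto. apply Rlt_le, Rinv_0_lt_compat, Hlp. }
  rewrite Rinv_1, !Rmult_1_l in S1.
  assert (S2 : dsk j t x * dsk j t x <= C) by (unfold C; lra).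
  apply Rabs_le; split; nra.
Qed.

(** * Times of small dissipation *)
Lemma energy_nonneg t : I t -> 0 <= energy t.
Proof.
  intro Ht. rewrite energy_eq by exact Ht.
  pose proof (q_nonneg ga I fam k t ltac:(smoothness) Ht).
  pose proof (len_pos ga I fam t Ht). nra.
Qed.

Lemma dissipation_small a b : 1 <= a -> a < b ->
  exists t, a < t < b /\ q V t * (b - a) <= E0.
Proof.
  intros Ha Hab.
  destruct (MVT_cor2 energy (fun r => - q V r) a b Hab) as [t [E Ht]].
  - intros r Hr. apply is_derive_Reals, energy_derive. unfold positive_time; lra.
  - exists t; split; [exact Ht|].
    pose proof (energy_nonneg b ltac:(unfold positive_time; lra)).
    pose proof (energy_decr 1 a ltac:(lra) Ha). fold E0 in *. lra.
Qed.

(** The mean value theorem on the intervals between consecutive [n^2 + 1], whose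
    lengths tend to infinity while the total dissipation is finite. *)
Lemma dissipative_times : exists t : nat -> R,
  (forall n, 1 <= t n) /\ (forall n, t n < t (S n)) /\ (forall n, INR n <= t n) /\
  (forall n, q V (t n) * INR n <= E0).
Proof.
  set (a := fun n : nat => INR n * INR n + 1).
  assert (Ha : forall n, 1 <= a n) by (intro n; unfold a; pose proof (pos_INR n); nra).
  assert (Hd : forall n, a (S n) - a n = 2 * INR n + 1)
    by (intro n; unfold a; rewrite S_INR; ring).
  assert (Hlt : forall n, a n < a (S n)).
  { intro n. specialize (Hd n). pose proof (pos_INR n). lra. }
  destruct (functional_choice (fun n t => a n < t < a (S n) /\ q V t * (a (S n) - a n) <= E0)) as [t Ht].
  { intro n. apply dissipation_small; auto. }
  exists t. split; [|split; [|split]]; intro n.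
  - destruct (Ht n) as [H _]. specialize (Ha n). lra.
  - destruct (Ht n) as [H _]. destruct (Ht (S n)) as [H' _]. lra.
  - destruct (Ht n) as [H _]. unfold a in H. pose proof (pos_INR n). nra.
  - destruct (Ht n) as [H H2]. rewrite Hd in H2.
    assert (It : I (t n)) by (specialize (Ha n); unfold positive_time; lra).
    pose proof (q_nonneg ga I fam V (t n) ltac:(smoothness) It). pose proof (pos_INR n). nra.
Qed.

Definition bounded_late (f : R -> R -> R) : Prop :=
  exists C, forall t x, 1 <= t -> Rabs (f t x) <= C.

Fixpoint ds_iter (n : nat) (f : R -> R -> R) : R -> R -> R :=
  match n with O => f | S n' => ds_iter n' (ds f) end.

(** Bounds for the first [n] arclength derivatives, uniform in time away from
    the initial instant.  They pass to products, hence to the tangent and to the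
    velocity from the curvature. *)
Fixpoint ds_bounded (n : nat) (f : R -> R -> R) : Prop :=
  bounded_late f /\ match n with O => True | S n' => ds_bounded n' (ds f) end.

Lemma ds_bounded_ext n : forall f g, eqI I f g -> ds_bounded n f -> ds_bounded n g.
Proof.
  induction n as [|n IH]; intros f g E [[C B] H].
  - split; [|trivial]. exists C; intros t x Ht; rewrite <- E by smoothness; auto.
  - split; [exists C; intros t x Ht; rewrite <- E by smoothness; auto|].
    apply (IH (ds f)); auto. apply (ds_ext ga I), E.
Qed.

Lemma ds_bounded_weaken n : forall f, ds_bounded (S n) f -> ds_bounded n f.
Proof.
  induction n as [|n IH]; intros f [B H]; split; auto.
Qed.

Lemma ds_bounded_const n c : ds_bounded n (fconst c).
Proof.
  revert c; induction n as [|n IH]; intro c; (split; [exists (Rabs c); intros; apply Rle_refl|auto]).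
  apply (ds_bounded_ext n (fconst 0)); [|apply IH].
  intros t x _. symmetry; apply ds_const.
Qed.

Lemma ds_bounded_add n : forall f g, circle_smooth I f -> circle_smooth I g ->
  ds_bounded n f -> ds_bounded n g -> ds_bounded n (fadd f g).
Proof.
  assert (B : forall f g, bounded_late f -> bounded_late g -> bounded_late (fadd f g)).
  { intros f g [C B] [C' B']. exists (C + C'). intros t x Ht. unfold fadd.
    eapply Rle_trans; [apply Rabs_triang|]. apply Rplus_le_compat; auto. }
  induction n as [|n IH]; intros f g Gf Gg [Bf Hf] [Bg Hg]; (split; [auto|]); [trivial|].
  apply (ds_bounded_ext n (fadd (ds f) (ds g))); [|apply IH; smoothness].
  intros t x Ht. symmetry; apply (ds_add ga I); auto.
Qed.

Lemma ds_bounded_mul n : forall f g, circle_smooth I f -> circle_smooth I g ->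
  ds_bounded n f -> ds_bounded n g -> ds_bounded n (fmul f g).
Proof.
  assert (B : forall f g, bounded_late f -> bounded_late g -> bounded_late (fmul f g)).
  { intros f g [C B] [C' B']. exists (C * C'). intros t x Ht. unfold fmul.
    rewrite Rabs_mult. apply Rmult_le_compat; auto using Rabs_pos. }
  induction n as [|n IH]; intros f g Gf Gg Hf Hg.
  - destruct Hf, Hg; split; auto.
  - pose proof (ds_bounded_weaken _ _ Hf). pose proof (ds_bounded_weaken _ _ Hg).
    destruct Hf as [Bf Hf], Hg as [Bg Hg]. split; [auto|].
    apply (ds_bounded_ext n (fadd (fmul (ds f) g) (fmul f (ds g)))).
    + intros t x Ht. symmetry; apply (ds_mul ga I); auto.
    + apply ds_bounded_add; smoothness.
Qed.

Lemma ds_bounded_dsk n : forall j, ds_bounded n (dsk j).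
Proof.
  induction n as [|n IH]; intro j.
  - split; [|trivial]. destruct (dsk_bounded j) as [C [_ B]]. exists C; exact B.
  - split; [|apply (IH (S j))]. destruct (dsk_bounded j) as [C [_ B]]. exists C; exact B.
Qed.

Lemma ds_bounded_tangent n : ds_bounded n ta /\ ds_bounded n tb.
Proof.
  assert (Ba : bounded_late ta) by (exists 1; intros; apply tangent_bound; smoothness).
  assert (Bb : bounded_late tb) by (exists 1; intros; apply tangent_bound; smoothness).
  induction n as [|n [IHa IHb]]; [split; split; auto|].
  split; (split; [auto|]).
  - apply (ds_bounded_ext n (fmul (fconst (-1)) (fmul k tb))).
    + apply eqI_sym, (ds_ta ga I fam).
    + apply ds_bounded_mul; smoothness; [apply ds_bounded_const|].
      apply ds_bounded_mul; smoothness. apply (ds_bounded_dsk n 0).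
  - apply (ds_bounded_ext n (fmul k ta)).
    + apply eqI_sym, (ds_tb ga I fam).
    + apply ds_bounded_mul; smoothness. apply (ds_bounded_dsk n 0).
Qed.

Lemma ds_bounded_V n : ds_bounded n V.
Proof.
  apply (ds_bounded_ext n _ _ (eqI_sym _ _ _ flow)).
  pose proof (ds_bounded_dsk n 0) as B0. change (dsk 0) with k in B0.
  pose proof (ds_bounded_dsk n 2) as B2.
  pose proof (ds_bounded_const n) as Bc.
  apply ds_bounded_add; smoothness; [|apply ds_bounded_add; smoothness];
    apply ds_bounded_mul; smoothness; apply ds_bounded_mul; smoothness.
  apply ds_bounded_mul; smoothness.
Qed.

Lemma ds_iter_bounded n f : ds_bounded n f -> bounded_late (ds_iter n f).
Proof.
  revert f; induction n as [|n IH]; intros f [B H]; [exact B|apply IH, H].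
Qed.

(** Smallness of the velocity in [L^2] together with a bound on its derivative
    gives smallness in sup norm. *)
Lemma V_vanishes (t : nat -> R) : (forall n, 1 <= t n) ->
  (forall n, q V (t n) * INR n <= E0) ->
  forall eps, 0 < eps -> exists N, forall n, (N <= n)%nat -> forall x,
    Rabs (V (t n) x) < eps.
Proof.
  intros Ht Hq eps Heps.
  destruct (proj2 (ds_bounded_V 1)) as [[C B] _].
  pose proof E0_pos as Ep.
  assert (Hm : 0 < E0 / mu) by (apply Rdiv_lt_0_compat; lra).
  set (M := C * C * (E0 / mu) + 1).
  assert (Mp : 0 < M) by (unfold M; pose proof (Rle_0_sqr C) as S; unfold Rsqr in S; nra).
  assert (HV : forall s, 1 <= s -> q (ds V) s <= M).
  { intros s Hs. assert (Is : I s) by smoothness.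
    apply Rle_trans with (J (fconst (C * C)) s).
    - apply (J_le ga I fam); smoothness. intro x. unfold fmul, fconst.
      specialize (B s x Hs). apply Rabs_le_between in B. nra.
    - rewrite (J_const ga I fam) by auto. unfold M.
      pose proof (len_le s Hs). pose proof (Rle_0_sqr C) as S; unfold Rsqr in S. nra. }
  (* weight making the derivative term of [sup_le] equal to [eps^2 / 4] *)
  set (d := 4 * M / (eps * eps)).
  assert (dp : 0 < d) by (apply Rdiv_lt_0_compat; nra).
  set (A := 2 * E0 + d). assert (Ap : 0 < A) by (unfold A; lra).
  (* from this [N] on, [A * q V <= eps^2 / 4] *)
  destruct (INR_unbounded (4 * A * E0 / (eps * eps))) as [N HN].
  exists N. intros n Hn x. specialize (Ht n). specialize (Hq n).
  assert (It : I (t n)) by smoothness.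
  pose proof (sup_le ga I fam V (t n) x d ltac:(smoothness) It dp) as S1.
  pose proof (HV (t n) Ht) as S2.
  pose proof (q_nonneg ga I fam V (t n) ltac:(smoothness) It) as Q0.
  set (Q := q V (t n)) in *.
  pose proof (len_pos ga I fam (t n) It) as Hlp.
  pose proof (inv_len_le (t n) Ht) as Hinv.
  assert (T1 : / len (t n) * Q <= 2 * E0 * Q) by (apply Rmult_le_compat_r; auto).
  assert (T2 : / d * q (ds V) (t n) <= eps * eps / 4).
  { apply Rle_trans with (/ d * M).
    - apply Rmult_le_compat_l; [apply Rlt_le, Rinv_0_lt_compat, dp|exact S2].
    - apply Req_le; unfold d; field; lra. }
  assert (HNn : INR N <= INR n) by (apply le_INR, Hn).
  assert (T3 : A * Q <= eps * eps / 4).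
  { assert (K1 : 4 * A * E0 < INR n * (eps * eps)).
    { assert (e2 : 0 < eps * eps) by nra.
      apply Rgt_lt, (Rmult_lt_compat_r (eps * eps) _ _ e2) in HN.
      replace (4 * A * E0 / (eps * eps) * (eps * eps)) with (4 * A * E0) in HN by (field; lra).
      apply Rlt_le_trans with (1 := HN). apply Rmult_le_compat_r; lra. }
    assert (Np : 0 < INR n).
    { assert (0 < A * E0) by (apply Rmult_lt_0_compat; lra).
      apply Rmult_lt_reg_r with (eps * eps); [nra|]. lra. }
    apply Rmult_le_reg_r with (4 * INR n); [lra|].
    replace (A * Q * (4 * INR n)) with (4 * A * (Q * INR n)) by ring.
    apply Rle_trans with (4 * A * E0); [apply Rmult_le_compat_l; lra|]. lra. }
  unfold A in T3.
  assert (S3 : V (t n) x * V (t n) x < eps * eps) by nra.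
  apply Rabs_def1; nra.
Qed.

End FlowEstimates.

(** * Constant speed parametrizations *)

Lemma positive_increasing (F f : R -> R) : (forall x, is_derive F x (f x)) ->
  (forall x, 0 < f x) -> forall x y, x < y -> F x < F y.
Proof.
  intros HF Hf x y Hxy.
  destruct (MVT_cor2 F f x y Hxy) as [c [E _]].
  - intros z _. apply is_derive_Reals, HF.
  - specialize (Hf c). nra.
Qed.

Lemma is_derive_continuity (F : R -> R) x l : is_derive F x l -> continuity_pt F x.
Proof.
  intro H. apply continuity_pt_filterlim, (ex_derive_continuous F). exists l; exact H.
Qed.

Lemma periodic_lower_bound (v : R -> R) : (forall x, continuous v x) ->
  (forall x, v (x + 1) = v x) -> (forall x, 0 < v x) ->
  exists m, 0 < m /\ forall x, m <= v x.
Proof.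
  intros Hc Hp Hv.
  destruct (continuity_ab_min v 0 1) as [a [Ha _]]; [lra| |].
  - intros c _. apply continuity_pt_filterlim, Hc.
  - exists (v a). split; [apply Hv|]. intro x.
    destruct (unit_interval_translate x) as [z Hz].
    rewrite <- (periodic_Z v Hp z x). apply Ha, Hz.
Qed.

Lemma periodic_upper_bound (v : R -> R) : (forall x, continuous v x) ->
  (forall x, v (x + 1) = v x) -> exists M, forall x, v x <= M.
Proof.
  intros Hc Hp.
  destruct (continuity_ab_maj v 0 1) as [a [Ha _]]; [lra| |].
  - intros c _. apply continuity_pt_filterlim, Hc.
  - exists (v a). intro x.
    destruct (unit_interval_translate x) as [z Hz].
    rewrite <- (periodic_Z v Hp z x). apply Ha, Hz.
Qed.

(** The lower bound [c] makes the right inverse [P] Lipschitz, which provides the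
    continuity that differentiating an inverse function requires. *)
Lemma inverse_derive (S s P : R -> R) (c : R) : 0 < c ->
  (forall x, is_derive S x (s x)) -> (forall x, c <= s x) ->
  (forall y, S (P y) = y) -> forall y, is_derive P y (/ s (P y)).
Proof.
  intros Hc HS Hs HP y.
  assert (Inc : forall x z, x < z -> c * (z - x) <= S z - S x).
  { intros x z Hxz.
    destruct (MVT_cor2 S s x z Hxz) as [e [E _]].
    - intros u _. apply is_derive_Reals, HS.
    - rewrite E. apply Rmult_le_compat_r; [lra|apply Hs]. }
  assert (Lip : forall u v, c * Rabs (u - v) <= Rabs (S u - S v)).
  { intros u v. destruct (Rtotal_order u v) as [H|[H|H]].
    - specialize (Inc u v H). rewrite (Rabs_minus_sym u), (Rabs_minus_sym (S u)).
      rewrite (Rabs_pos_eq (v - u)) by lra. rewrite Rabs_pos_eq by nra. lra.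
    - subst. rewrite !Rminus_diag, Rabs_R0. lra.
    - specialize (Inc v u H).
      rewrite (Rabs_pos_eq (u - v)) by lra. rewrite Rabs_pos_eq by nra. lra. }
  apply is_derive_Reals. intros eps Heps.
  pose proof (HS (P y)) as D. apply is_derive_Reals in D.
  destruct (D (eps * (c * c))) as [d Hd]; [apply Rmult_lt_0_compat; nra|].
  assert (dp : 0 < c * d) by (apply Rmult_lt_0_compat; [lra|apply cond_pos]).
  exists (mkposreal _ dp). intros h Hh Hhd. simpl in Hhd.
  set (u := P (y + h) - P y).
  assert (Su : S (P y + u) - S (P y) = h).
  { unfold u. replace (P y + (P (y + h) - P y)) with (P (y + h)) by ring.
    rewrite !HP. ring. }
  assert (Hu : u <> 0).
  { intro E. rewrite E, Rplus_0_r, Rminus_diag in Su. auto. }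
  pose proof (Lip (P y + u) (P y)) as L. rewrite Su in L.
  replace (P y + u - P y) with u in L by ring.
  assert (Hud : Rabs u < d).
  { apply Rmult_lt_reg_l with c; [exact Hc|]. lra. }
  specialize (Hd u Hu Hud). rewrite Su in Hd.
  specialize (Hs (P y)). set (e := s (P y)) in *. set (q := h / u) in *.
  assert (Hq : c <= q).
  { unfold q. destruct (Rtotal_order u 0) as [H|[H|H]]; [|contradiction|].
    - specialize (Inc (P y + u) (P y) ltac:(lra)).
      apply Rmult_le_reg_r with (- u); [lra|].
      replace (h / u * - u) with (- h) by (field; auto). lra.
    - specialize (Inc (P y) (P y + u) ltac:(lra)).
      apply Rmult_le_reg_r with u; [lra|].
      replace (h / u * u) with h by (field; auto). lra. }
  replace (u / h - / e) with (- ((q - e) * / (q * e))) by (unfold q; field; lra).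
  rewrite Rabs_Ropp, Rabs_mult.
  assert (Hqe : c * c <= q * e) by (apply Rmult_le_compat; lra).
  rewrite (Rabs_pos_eq (/ (q * e))) by (apply Rlt_le, Rinv_0_lt_compat; nra).
  apply Rmult_lt_reg_r with (q * e); [nra|].
  rewrite Rmult_assoc, Rinv_l, Rmult_1_r by nra.
  apply Rlt_le_trans with (1 := Hd). apply Rmult_le_compat_l; lra.
Qed.

(** [P] inverts the normalized arclength [x |-> (int_0^x v) / L], which is an
    increasing bijection because it commutes with the unit translation. *)
Lemma constant_speed_parameter (v : R -> R) : (forall x, continuous v x) ->
  (forall x, v (x + 1) = v x) -> (forall x, 0 < v x) ->
  exists P : R -> R, (forall x, is_derive P x (RInt v 0 1 / v (P x))) /\
    (forall x, P (x + 1) = P x + 1).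
Proof.
  intros Hc Hp Hv. set (L := RInt v 0 1).
  assert (E : forall a b, ex_RInt v a b) by (intros; apply (ex_RInt_continuous v); auto).
  assert (Lp : 0 < L) by (apply RInt_gt_0; auto; lra).
  set (S := fun x => RInt v 0 x / L).
  assert (HI : forall x, is_derive (fun x => RInt v 0 x) x (v x)).
  { intro x. apply (is_derive_RInt v (fun x => RInt v 0 x) 0 x); auto.
    apply filter_forall. intro y. apply (RInt_correct v 0 y); auto. }
  assert (HS : forall x, is_derive S x (v x / L)).
  { intro x. unfold S. apply (is_derive_ext (fun x => / L * RInt v 0 x)).
    - intro y. unfold Rdiv. apply Rmult_comm.
    - replace (v x / L) with (/ L * v x) by (unfold Rdiv; ring).
      apply (is_derive_scal (fun x => RInt v 0 x)). apply HI. }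
  assert (Spos : forall x, 0 < v x / L) by (intro; apply Rdiv_lt_0_compat; auto).
  assert (S0 : S 0 = 0) by (unfold S; rewrite RInt_point; unfold zero; simpl; field; lra).
  assert (S1 : S 1 = 1) by (unfold S; fold L; field; lra).
  assert (Sper : forall x, S (x + 1) = S x + 1).
  { intro x. set (D := fun x => S (x + 1) - S x).
    assert (HD : forall z, is_derive D z 0).
    { intro z. unfold D. replace 0 with (minus (v z / L) (v z / L)) 
      by (unfold minus, plus, opp; simpl; ring).
      apply (is_derive_minus (fun z => S (z + 1)) S); auto.
      replace (v z / L) with (scal 1 (v (z + 1) / L)) by (rewrite Hp; apply (scal_one (v z / L))).
      apply (is_derive_comp S (fun z => z + 1)); auto.
      auto_derive; auto; ring. }
    assert (DD : D x = D 0).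
    { destruct (MVT_gen D 0 x (fun _ => 0)) as [c [_ Ec]].
      - intros; apply HD.
      - intros; apply (is_derive_continuity D _ 0), HD.
      - lra. }
    unfold D in DD. rewrite Rplus_0_l, S0, S1 in DD. lra. }
  assert (SZ : forall z, S (IZR z) = IZR z).
  { intro z. assert (Q0 : forall x, S (x + 1) - (x + 1) = S x - x)
      by (intro x; rewrite Sper; ring).
    pose proof (periodic_Z (fun x => S x - x) Q0 z 0) as Q. cbv beta in Q.
    rewrite Rplus_0_l, S0 in Q. lra. }
  assert (Sinc : forall x y, x < y -> S x < S y) by (apply (positive_increasing S _ HS Spos)).
  assert (Sinj : forall x y, S x = S y -> x = y).
  { intros x y Exy. destruct (Rtotal_order x y) as [H|[H|H]]; auto;
      apply Sinc in H; lra. }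
  destruct (functional_choice (fun y x => S x = y)) as [P HP].
  { intro y. destruct (archimed y) as [A1 A2].
    destruct (IVT_gen S (IZR (up y - 1)) (IZR (up y)) y) as [x [_ Hx]].
    - intro z. apply (is_derive_continuity S z (v z / L)), HS.
    - rewrite !SZ, minus_IZR. rewrite Rmin_left, Rmax_right by lra. lra.
    - exists x; exact Hx. }
  exists P. split.
  - destruct (periodic_lower_bound v Hc Hp Hv) as [m [mp Hm]].
    intro y. replace (L / v (P y)) with (/ (v (P y) / L)) 
      by (specialize (Hv (P y)); field; split; apply Rgt_not_eq; assumption).
    apply (inverse_derive S (fun x => v x / L) P (m / L)); auto.
    + apply Rdiv_lt_0_compat; auto.
    + intro x. apply Rmult_le_compat_r; [apply Rlt_le, Rinv_0_lt_compat, Lp|apply Hm].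
  - intro x. apply Sinj. rewrite Sper, !HP. reflexivity.
Qed.

Lemma Derive_n_of_derive (f h : R -> R) : (forall x, is_derive f x (h x)) ->
  forall n x, Derive_n f (S n) x = Derive_n h n x.
Proof.
  intros H n. induction n as [|n IH]; intro x.
  - apply is_derive_unique, H.
  - apply Derive_ext, IH.
Qed.

Lemma smooth_of_derive (f h : R -> R) : (forall x, is_derive f x (h x)) ->
  smooth h -> smooth f.
Proof.
  intros H Hh n x. destruct n as [|[|n]]; [exact Logic.I| |].
  - exists (h x); apply H.
  - apply (ex_derive_ext (Derive_n h n)).
    + intro y; symmetry; apply (Derive_n_of_derive f h H).
    + apply (Hh (S n)).
Qed.

Section Slices.

Variable ga : R -> R -> R * R.
Variable I : R -> Prop.
Hypothesis fam : family I ga.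
Let I_open := family_open I ga fam.
Notation ds := (ds ga).
Notation w := (w ga).

(** In a constant speed parameter, differentiation in space is [L] times the
    arclength derivative.  Hence the derivatives of the reparametrized curve are
    geometric quantities, and [P] itself inherits smoothness. *)
Lemma Derive_n_reparam (P : R -> R) (L t : R) : I t ->
  (forall x, is_derive P x (L / w t (P x))) ->
  forall n f, circle_smooth I f ->
   (forall x, ex_derive_n (fun x => f t (P x)) n x) /\
   (forall x, Derive_n (fun x => f t (P x)) n x = L ^ n * ds_iter ga n f t (P x)).
Proof.
  intros Ht HP n.
  assert (D : forall f, circle_smooth I f -> forall x,
    is_derive (fun x => f t (P x)) x (L * ds f t (P x))).
  { intros f Hf x.
    replace (L * ds f t (P x)) with (scal (L / w t (P x)) (w t (P x) * ds f t (P x))).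
    - apply (is_derive_comp (f t) P); [|apply HP].
      apply (circle_smooth_is_derive ga I fam); auto.
    - pose proof (w_pos ga I fam t (P x) Ht). unfold scal; simpl; unfold mult; simpl.
      field. lra. }
  induction n as [|n IH]; intros f Hf.
  - split; [intro; exact Logic.I | intro x; simpl; ring].
  - destruct (IH (ds f) ltac:(smoothness)) as [H1 H2].
    assert (Q : forall m x, Derive_n (fun x => f t (P x)) (S m) x
                = L * Derive_n (fun x => ds f t (P x)) m x).
    { intros m x. rewrite (Derive_n_of_derive _ (fun x => L * ds f t (P x)) (D f Hf)).
      apply Derive_n_scal_l. }
    split.
    + intro x. destruct n as [|n].
      * exists (L * ds f t (P x)). apply D, Hf.
      * apply (ex_derive_ext (fun y => L * Derive_n (fun x => ds f t (P x)) n y)).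
        -- intro y. symmetry. apply Q.
        -- apply ex_derive_scal, H1.
    + intro x. rewrite Q, H2. simpl. ring.
Qed.

Lemma smooth_reparam (P : R -> R) (L t : R) : I t ->
  (forall x, is_derive P x (L / w t (P x))) ->
  forall f, circle_smooth I f -> smooth (fun x => f t (P x)).
Proof.
  intros Ht HP f Hf n x. apply (Derive_n_reparam P L t Ht HP n f Hf).
Qed.

Lemma constant_speed_reparametrization t : I t ->
  exists P, reparametrization P /\
    forall x, is_derive P x (curve_length ga t / w t (P x)).
Proof.
  intro Ht.
  assert (Lp := len_pos ga I fam t Ht).
  assert (El : RInt (w t) 0 1 = curve_length ga t).
  { apply RInt_ext. intros x _. unfold fconst. symmetry; apply Rmult_1_l. }
  destruct (constant_speed_parameter (w t)) as [P [HP Hper]].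
  - intro x. apply (circle_smooth_continuous I w); smoothness.
  - intro x. apply (circle_smooth_w ga I fam), Ht.
  - intro x. apply (w_pos ga I fam), Ht.
  - rewrite El in HP. exists P. split; [|exact HP]. split; [|split; [|exact Hper]].
    + apply (smooth_of_derive P _ HP).
      assert (Gi : circle_smooth I (fmul (fconst (curve_length ga t)) (fun t x => / w t x))).
      { apply circle_smooth_mul; smoothness. apply circle_smooth_inv; smoothness.
        intros s x Hs. apply Rgt_not_eq, (w_pos ga I fam), Hs. }
      exact (smooth_reparam P _ t Ht HP _ Gi).
    + intro x. rewrite (is_derive_unique _ _ _ (HP x)).
      apply Rdiv_lt_0_compat; [exact Lp|apply (w_pos ga I fam), Ht].
Qed.

End Slices.

(** * Smooth compactness *)

Definition extraction (e : nat -> nat) : Prop := forall n, (e n < e (S n))%nat.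

Lemma extraction_lt e : extraction e -> forall n m, (n < m)%nat -> (e n < e m)%nat.
Proof.
  intros He n m H. induction H as [|m H IH]; [apply He|].
  eapply Nat.lt_trans; [exact IH|apply He].
Qed.

Lemma extraction_ge e : extraction e -> forall n, (n <= e n)%nat.
Proof.
  intros He n. induction n as [|n IH]; [lia|]. specialize (He n). lia.
Qed.

Lemma extraction_comp e f : extraction e -> extraction f -> extraction (fun n => e (f n)).
Proof. intros He Hf n. apply extraction_lt; auto. Qed.

Lemma bounded_extraction (u : nat -> R) (C : R) : (forall n, Rabs (u n) <= C) ->
  exists e, extraction e /\ exists l : R, is_lim_seq (fun n => u (e n)) l.
Proof.
  intro H.
  destruct (Bolzano_Weierstrass u (fun x => - C <= x <= C)) as [l Hl].
  - apply compact_P3.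
  - intro n. apply Rabs_le_between, H.
  - assert (A : forall p : nat * nat, exists m, (S (fst p) <= m)%nat /\
        Rabs (u m - l) < / (INR (snd p) + 1)).
    { intros [N n]. simpl.
      assert (P : 0 < / (INR n + 1)) by (apply Rinv_0_lt_compat; pose proof (pos_INR n); lra).
      destruct (Hl (fun x => Rabs (x - l) < / (INR n + 1)) (S N)) as [m [Hm1 Hm2]].
      - exists (mkposreal _ P). intros x Hx. exact Hx.
      - exists m; split; auto. }
    destruct (functional_choice _ A) as [g Hg].
    set (e := fix e n := match n with O => g (O, O) | S n' => g (e n', S n') end).
    exists e. split.
    + intro n. destruct (Hg (e n, S n)) as [H1 _]. exact H1.
    + exists l. apply is_lim_seq_spec. intro eps.
      destruct (INR_unbounded (/ eps)) as [N HN].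
      exists N. intros n Hn.
      assert (Hd : Rabs (u (e n) - l) < / (INR n + 1)).
      { destruct n as [|n]; [apply (proj2 (Hg (O, O)))|apply (proj2 (Hg (e n, S n)))]. }
      apply Rlt_trans with (1 := Hd).
      rewrite <- (Rinv_inv eps). apply Rinv_lt_contravar.
      * apply Rmult_lt_0_compat; [apply Rinv_0_lt_compat, cond_pos|].
        pose proof (pos_INR n); lra.
      * apply le_INR in Hn. lra.
Qed.

Lemma diagonal_extraction (s : nat -> nat -> R) :
  (forall i, exists C, forall n, Rabs (s i n) <= C) ->
  exists e, extraction e /\ forall i, exists l : R, is_lim_seq (fun n => s i (e n)) l.
Proof.
  intro H.
  assert (A : forall p : nat * (nat -> nat), exists t, extraction t /\
      exists l : R, is_lim_seq (fun n => s (fst p) (snd p (t n))) l).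
  { intros [i f]. destruct (H i) as [C HC]. simpl.
    apply (bounded_extraction (fun n => s i (f n)) C); auto. }
  destruct (functional_choice _ A) as [T HT].
  set (E := fix E i := match i with
     | O => T (O, fun n => n)
     | S i' => fun n => E i' (T (S i', E i') n) end).
  assert (HE : forall i, extraction (E i)).
  { induction i as [|i IH]; [apply (HT (O, fun n => n))|].
    apply (extraction_comp (E i) (T (S i, E i))); auto. apply HT. }
  assert (HL : forall i, exists l : R, is_lim_seq (fun n => s i (E i n)) l).
  { intros [|i]; [apply (HT (O, fun n => n))|apply (HT (S i, E i))]. }
  assert (Hsub : forall i j, exists r, extraction r /\ forall n, E (j + i)%nat n = E i (r n)).
  { intros i j; induction j as [|j [r [Hr Er]]].
    - exists (fun n => n); split; [intro n; lia|reflexivity].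
    - exists (fun n => r (T (S (j + i)%nat, E (j + i)%nat) n)); split.
      + apply extraction_comp; auto. apply HT.
      + intro n. apply (Er (T (S (j + i)%nat, E (j + i)%nat) n)). }
  exists (fun n => E n n). split.
  - intro n. change (E (S n) (S n)) with (E n (T (S n, E n) (S n))).
    apply extraction_lt; [apply HE|].
    pose proof (extraction_ge _ (proj1 (HT (S n, E n))) (S n)). lia.
  - intro i. destruct (HL i) as [l Hl]. exists l.
    apply is_lim_seq_spec. apply is_lim_seq_spec in Hl.
    intro eps. destruct (Hl eps) as [N HN].
    exists (N + i)%nat. intros n Hn.
    destruct (Hsub i (n - i)%nat) as [r [Hr Er]].
    replace (n - i + i)%nat with n in Er by lia. rewrite Er.
    apply HN. pose proof (extraction_ge r Hr n). lia.
Qed.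

Lemma smooth_is_derive h m x : smooth h -> is_derive (Derive_n h m) x (Derive_n h (S m) x).
Proof. intro H. apply Derive_correct, (H (S m) x). Qed.

Lemma Derive_n_periodic h m : smooth h -> (forall x, h (x + 1) = h x) ->
  forall x, Derive_n h m (x + 1) = Derive_n h m x.
Proof.
  intros H Hp. induction m as [|m IH]; [exact Hp|].
  intro x. apply (Derive_periodic (Derive_n h m)); auto. apply (H (S m)).
Qed.

Lemma lipschitz_of_derive (F f : R -> R) C : (forall x, is_derive F x (f x)) ->
  (forall x, Rabs (f x) <= C) -> forall x y, Rabs (F x - F y) <= C * Rabs (x - y).
Proof.
  intros HF Hf x y.
  destruct (MVT_gen F y x f) as [c [_ E]].
  - intros; apply HF.
  - intros z _. apply (is_derive_continuity F z (f z)), HF.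
  - rewrite E, Rabs_mult. apply Rmult_le_compat_r; [apply Rabs_pos|apply Hf].
Qed.

Lemma taylor_of_derive (F f f' : R -> R) C : (forall x, is_derive F x (f x)) ->
  (forall x, is_derive f x (f' x)) -> (forall x, Rabs (f' x) <= C) ->
  forall x y, Rabs (F y - F x - (y - x) * f x) <= C * (Rabs (y - x) * Rabs (y - x)).
Proof.
  intros HF Hf Hf' x y.
  destruct (MVT_gen F x y f) as [c [Hc E]].
  - intros; apply HF.
  - intros z _. apply (is_derive_continuity F z (f z)), HF.
  - rewrite E. replace (f c * (y - x) - (y - x) * f x) with ((f c - f x) * (y - x)) by ring.
    rewrite Rabs_mult, <- Rmult_assoc. apply Rmult_le_compat_r; [apply Rabs_pos|].
    apply Rle_trans with (1 := lipschitz_of_derive f f' C Hf Hf' c x).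
    apply Rmult_le_compat_l.
    + apply Rle_trans with (2 := Hf' x), Rabs_pos.
    + unfold Rmin, Rmax in Hc. unfold Rabs.
      destruct (Rle_dec x y), (Rcase_abs (c - x)), (Rcase_abs (y - x)); lra.
Qed.

Lemma finite_max_index (P : nat -> nat -> Prop) (b : nat) :
  (forall a, exists N, forall n, (N <= n)%nat -> P a n) ->
  exists N, forall a n, (a <= b)%nat -> (N <= n)%nat -> P a n.
Proof.
  intro H. induction b as [|b [N HN]].
  - destruct (H O) as [N HN]. exists N. intros a n Ha Hn.
    replace a with O by lia. auto.
  - destruct (H (S b)) as [N' HN']. exists (N + N')%nat. intros a n Ha Hn.
    destruct (Nat.eq_dec a (S b)) as [->|Ne]; [apply HN'; lia|apply HN; lia].
Qed.

Lemma grid_point (b : nat) x : 0 <= x <= 1 ->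
  exists a, (a <= S b)%nat /\ Rabs (x - INR a / INR (S b)) <= / INR (S b).
Proof.
  intro Hx. assert (Bp : 0 < INR (S b)) by (apply lt_0_INR; lia).
  destruct (nfloor_ex (x * INR (S b))) as [a Ha]; [apply Rmult_le_pos; lra|].
  exists a. split.
  - apply INR_le. apply Rle_trans with (1 := proj1 Ha).
    rewrite <- (Rmult_1_l (INR (S b))) at 2. apply Rmult_le_compat_r; lra.
  - replace (x - INR a / INR (S b)) with ((x * INR (S b) - INR a) * / INR (S b))
      by (field; lra).
    rewrite Rabs_mult, (Rabs_pos_eq (/ INR (S b))) by (apply Rlt_le, Rinv_0_lt_compat, Bp).
    rewrite <- (Rmult_1_l (/ INR (S b))) at 2.
    apply Rmult_le_compat_r; [apply Rlt_le, Rinv_0_lt_compat, Bp|].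
    rewrite Rabs_pos_eq; lra.
Qed.

Definition smooth_limit (u : nat -> R -> R) (l : R -> R) : Prop :=
  forall m eps, 0 < eps -> exists N, forall n, (N <= n)%nat -> forall x,
    Rabs (Derive_n (u n) m x - Derive_n l m x) < eps.

(** Arzela-Ascoli for all derivatives at once.  A diagonal sequence converges in
    every derivative at every point of every uniform grid; the Lipschitz bounds
    make it uniformly Cauchy in every derivative, and Taylor bounds identify the
    limits as derivatives of one another. *)
Lemma smooth_compactness (u : nat -> R -> R) :
  (forall n, smooth (u n)) -> (forall n x, u n (x + 1) = u n x) ->
  (forall m, exists C, forall n x, Rabs (Derive_n (u n) m x) <= C) ->
  exists e l, extraction e /\ smooth l /\ smooth_limit (fun n => u (e n)) l.
Proof.
  intros Hs Hp HC.
  (* derivatives of every order at the points a / (b + 1) *)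
  set (s := fun i n => Derive_n (u n) (fst (of_nat i))
     (INR (fst (of_nat (snd (of_nat i)))) / INR (S (snd (of_nat (snd (of_nat i))))))).
  destruct (diagonal_extraction s) as [e [He Hl]].
  { intro i. destruct (HC (fst (of_nat i))) as [C B]. exists C. intro n; apply B. }
  set (v := fun n => u (e n)).
  assert (Grid : forall m a b, exists l : R,
      is_lim_seq (fun n => Derive_n (v n) m (INR a / INR (S b))) l).
  { intros m a b. destruct (Hl (to_nat (m, to_nat (a, b)))) as [l L]. exists l.
    unfold s in L. rewrite cancel_of_to in L. cbn [fst snd] in L.
    rewrite cancel_of_to in L. exact L. }
  assert (Cauchy : forall m eps, 0 < eps -> exists N, forall n n', (N <= n)%nat ->
      (N <= n')%nat -> forall x, Rabs (Derive_n (v n) m x - Derive_n (v n') m x) < eps).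
  { intros m eps Heps. destruct (HC (S m)) as [C B].
    assert (Cp : 0 <= C) by (apply Rle_trans with (2 := B O 0), Rabs_pos).
    destruct (INR_unbounded (4 * C / eps)) as [b Hb].
    assert (Bp : 0 < INR (S b)) by (apply lt_0_INR; lia).
    assert (Hsmall : C * / INR (S b) <= eps / 4).
    { apply Rmult_le_reg_r with (INR (S b)); [exact Bp|].
      rewrite Rmult_assoc, Rinv_l, Rmult_1_r by lra.
      rewrite S_INR. apply Rmult_le_reg_r with (4 / eps); [apply Rdiv_lt_0_compat; lra|].
      replace (eps / 4 * (INR b + 1) * (4 / eps)) with (INR b + 1) by (field; lra).
      replace (C * (4 / eps)) with (4 * C / eps) by (field; lra). lra. }
    destruct (finite_max_index (fun a n => forall n', (n <= n')%nat ->
       Rabs (Derive_n (v n) m (INR a / INR (S b)) -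
             Derive_n (v n') m (INR a / INR (S b))) < eps / 4) (S b)) as [N HN].
    { intro a. destruct (Grid m a b) as [l L]. apply is_lim_seq_spec in L.
      assert (E8 : 0 < eps / 8) by lra.
      destruct (L (mkposreal _ E8)) as [N HN]. exists N. intros n Hn n' Hn'.
      pose proof (HN n Hn) as H1. pose proof (HN n' ltac:(lia)) as H2. cbn -[INR Derive_n] in H1, H2.
      apply Rabs_lt_between in H1. apply Rabs_lt_between in H2.
      apply Rabs_def1; lra. }
    exists N. intros n n' Hn Hn' x0.
    assert (X : exists x, 0 <= x <= 1 /\ forall k, Derive_n (v k) m x0 = Derive_n (v k) m x).
    { destruct (unit_interval_translate x0) as [z Hz]. exists (x0 + IZR z).
      split; [exact Hz|]. intro k. symmetry.
      apply (periodic_Z (Derive_n (v k) m)). intro y.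
      apply Derive_n_periodic; [apply Hs|intro; apply Hp]. }
    destruct X as [x [Hx Ex]]. rewrite !Ex.
    destruct (grid_point b x Hx) as [a [Ha Hxa]].
    set (p := INR a / INR (S b)) in *.
    assert (Lip : forall k, Rabs (Derive_n (v k) m x - Derive_n (v k) m p) <= eps / 4).
    { intro k. apply Rle_trans with (C * Rabs (x - p)).
      - apply (lipschitz_of_derive _ (Derive_n (v k) (S m))).
        + intro y; apply smooth_is_derive, Hs.
        + intro y; apply B.
      - apply Rle_trans with (2 := Hsmall). apply Rmult_le_compat_l; auto. }
    pose proof (Lip n) as L1. pose proof (Lip n') as L2.
    assert (G : Rabs (Derive_n (v n) m p - Derive_n (v n') m p) < eps / 2).
    { pose proof (HN a N Ha (le_n N)) as G0.
      pose proof (G0 n Hn) as G1. pose proof (G0 n' Hn') as G2. fold p in G1, G2.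
      apply Rabs_lt_between in G1. apply Rabs_lt_between in G2. apply Rabs_def1; lra. }
    apply Rabs_le_between in L1. apply Rabs_le_between in L2. apply Rabs_lt_between in G.
    apply Rabs_def1; lra. }
  destruct (functional_choice (fun (p : nat * R) (l : R) =>
     is_lim_seq (fun n => Derive_n (v n) (fst p) (snd p)) l)) as [lim Hlim].
  { intros [m x]. simpl.
    assert (ex_finite_lim_seq (fun n => Derive_n (v n) m x)) as [l L].
    { apply ex_lim_seq_cauchy_corr. intro eps.
      destruct (Cauchy m eps (cond_pos eps)) as [N HN].
      exists N. intros n n' Hn Hn'. apply HN; auto. }
    exists l; exact L. }
  set (F := fun m x => lim (m, x)).
  assert (HF : forall m x, is_lim_seq (fun n => Derive_n (v n) m x) (F m x))
    by (intros m x; apply (Hlim (m, x))).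
  assert (Unif : forall m eps, 0 < eps -> exists N, forall n, (N <= n)%nat -> forall x,
      Rabs (Derive_n (v n) m x - F m x) < eps).
  { intros m eps Heps. destruct (Cauchy m (eps / 2)) as [N HN]; [lra|].
    exists N. intros n Hn x.
    pose proof (HF m x) as L. apply is_lim_seq_spec in L.
    assert (E2 : 0 < eps / 2) by lra.
    destruct (L (mkposreal _ E2)) as [N' HN']. cbn -[INR Derive_n] in HN'.
    pose proof (HN n (N + N')%nat Hn ltac:(lia) x) as H1.
    pose proof (HN' (N + N')%nat ltac:(lia)) as H2.
    apply Rabs_lt_between in H1. apply Rabs_lt_between in H2. apply Rabs_def1; lra. }
  (* the quadratic Taylor bounds of the sequence pass to the pointwise limits *)
  assert (DF : forall m x, is_derive (F m) x (F (S m) x)).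
  { intros m x. destruct (HC (S (S m))) as [C B].
    assert (Cp : 0 <= C) by (apply Rle_trans with (2 := B O 0), Rabs_pos).
    assert (T : forall y, Rabs (F m y - F m x - (y - x) * F (S m) x)
                  <= C * (Rabs (y - x) * Rabs (y - x))).
    { intro y.
      assert (L : is_lim_seq (fun n => Rabs (Derive_n (v n) m y - Derive_n (v n) m x
           - (y - x) * Derive_n (v n) (S m) x))
          (Rabs (F m y - F m x - (y - x) * F (S m) x))).
      { apply (is_lim_seq_abs _ (Finite _)). apply is_lim_seq_minus'.
        - apply is_lim_seq_minus'; apply HF.
        - apply (is_lim_seq_scal_l _ (y - x) (Finite _)). apply HF. }
      pose proof (is_lim_seq_le _ (fun _ => C * (Rabs (y - x) * Rabs (y - x))) _ _
        (fun n => taylor_of_derive (Derive_n (v n) m) (Derive_n (v n) (S m))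
           (Derive_n (v n) (S (S m))) C
           (fun z => smooth_is_derive _ m z (Hs (e n)))
           (fun z => smooth_is_derive _ (S m) z (Hs (e n)))
           (fun z => B (e n) z) x y) L (is_lim_seq_const _)) as R1.
      exact R1. }
    apply is_derive_Reals. intros eps Heps.
    assert (dp : 0 < eps / (C + 1)) by (apply Rdiv_lt_0_compat; lra).
    exists (mkposreal _ dp). intros h Hh Hhd. simpl in Hhd.
    specialize (T (x + h)). replace (x + h - x) with h in T by ring.
    assert (hp : 0 < Rabs h) by (apply Rabs_pos_lt, Hh).
    replace ((F m (x + h) - F m x) / h - F (S m) x) with
      ((F m (x + h) - F m x - h * F (S m) x) * / h) by (field; auto).
    rewrite Rabs_mult, Rabs_inv.
    apply Rmult_lt_reg_r with (Rabs h); [exact hp|].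
    rewrite Rmult_assoc, Rinv_l, Rmult_1_r by lra.
    apply Rle_lt_trans with (1 := T). rewrite <- Rmult_assoc.
    apply Rmult_lt_compat_r; [exact hp|].
    apply Rle_lt_trans with (C * (eps / (C + 1))); [apply Rmult_le_compat_l; lra|].
    apply Rmult_lt_reg_r with (C + 1); [lra|].
    replace (C * (eps / (C + 1)) * (C + 1)) with (C * eps) by (field; lra). nra. }
  assert (EF : forall m x, Derive_n (F O) m x = F m x).
  { induction m as [|m IH]; intro x; [reflexivity|].
    simpl. rewrite (Derive_ext _ (F m)) by exact IH.
    apply is_derive_unique, DF. }
  exists e, (F O). split; [exact He|]. split.
  - intros n x. destruct n as [|n]; [exact Logic.I|].
    apply (ex_derive_ext (F n)); [intro y; symmetry; apply EF|].
    exists (F (S n) x); apply DF.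
  - intros m eps Heps. destruct (Unif m eps Heps) as [N HN].
    exists N. intros n Hn x. rewrite EF. apply HN, Hn.
Qed.

Lemma smooth_limit_extraction u l e : extraction e -> smooth_limit u l ->
  smooth_limit (fun n => u (e n)) l.
Proof.
  intros He H m eps Heps. destruct (H m eps Heps) as [N HN].
  exists N. intros n Hn x. apply HN. pose proof (extraction_ge e He n). lia.
Qed.

Lemma smooth_limit_pointwise u l m x : smooth_limit u l ->
  is_lim_seq (fun n => Derive_n (u n) m x) (Derive_n l m x).
Proof.
  intro H. apply is_lim_seq_spec. intro eps.
  destruct (H m eps (cond_pos eps)) as [N HN]. exists N. intros n Hn. apply HN, Hn.
Qed.

(** * Equation and criticality of the limit *)

(** The elastica operator [2 k_ss + k^3 - mu k] of a curve of constant speed [L],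
    multiplied by [L^9] and written with the derivatives [xi], [yi] of its
    coordinates, [L^2] being replaced by the squared speed.  As a polynomial it is
    continuous under smooth convergence. *)
Definition elastica_poly (mu x1 x2 x3 x4 y1 y2 y3 y4 : R) : R :=
  let S := x1 * x1 + y1 * y1 in
  let K := x1 * y2 - y1 * x2 in
  2 * (x1 * y4 - y1 * x4 + x2 * y3 - x3 * y2) * (S * S) + K * K * K - mu * K * (S * S * S).

Lemma elastica_poly_lim mu (u1 u2 u3 u4 v1 v2 v3 v4 : nat -> R)
  (x1 x2 x3 x4 y1 y2 y3 y4 : R) :
  is_lim_seq u1 x1 -> is_lim_seq u2 x2 -> is_lim_seq u3 x3 -> is_lim_seq u4 x4 ->
  is_lim_seq v1 y1 -> is_lim_seq v2 y2 -> is_lim_seq v3 y3 -> is_lim_seq v4 y4 ->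
  is_lim_seq (fun n => elastica_poly mu (u1 n) (u2 n) (u3 n) (u4 n)
                                        (v1 n) (v2 n) (v3 n) (v4 n))
    (elastica_poly mu x1 x2 x3 x4 y1 y2 y3 y4).
Proof.
  intros. unfold elastica_poly. cbv zeta.
  repeat lazymatch goal with
  | |- is_lim_seq (fun n => _ - _) _ => apply is_lim_seq_minus'
  | |- is_lim_seq (fun n => _ + _) _ => apply is_lim_seq_plus'
  | |- is_lim_seq (fun n => _ * _) _ => apply is_lim_seq_mult'
  | |- _ => first [assumption | apply is_lim_seq_const]
  end.
Qed.
Section ElasticaPolynomial.

Variable ga : R -> R -> R * R.
Variable I : R -> Prop.
Hypothesis fam : family I ga.
Let I_open := family_open I ga fam.
Notation ds := (ds ga).
Notation w := (w ga).
Notation k := (k ga).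
Notation ta := (ta ga).
Notation tb := (tb ga).
Notation dsk := (dsk ga).
#[local] Hint Resolve circle_smooth_dsk : smoothness.

Lemma ds_iter_ext n : forall f g, eqI I f g -> eqI I (ds_iter ga n f) (ds_iter ga n g).
Proof.
  induction n as [|n IH]; intros f g H; [exact H|].
  apply IH, (ds_ext ga I), H.
Qed.

Lemma ds2_ta : eqI I (ds (ds ta))
  (fadd (fmul (fconst (-1)) (fmul (dsk 1) tb)) (fmul (fconst (-1)) (fmul (fmul k k) ta))).
Proof.
  intros t x Ht. rewrite (ds_ext ga I _ _ (ds_ta ga I fam) t x Ht).
  rewrite (ds_scal ga I fam), (ds_mul ga I), (ds_tb ga I fam) by smoothness.
  unfold fadd, fmul, fconst; simpl; ring.
Qed.

Lemma ds2_tb : eqI I (ds (ds tb))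
  (fadd (fmul (dsk 1) ta) (fmul (fconst (-1)) (fmul (fmul k k) tb))).
Proof.
  intros t x Ht. rewrite (ds_ext ga I _ _ (ds_tb ga I fam) t x Ht).
  rewrite (ds_mul ga I), (ds_ta ga I fam) by smoothness.
  unfold fadd, fmul, fconst; simpl; ring.
Qed.

Lemma ds3_ta t x : I t -> ds (ds (ds ta)) t x =
  - dsk 2 t x * tb t x - 3 * k t x * dsk 1 t x * ta t x + k t x * k t x * k t x * tb t x.
Proof.
  intro Ht. rewrite (ds_ext ga I _ _ ds2_ta t x Ht).
  rewrite (ds_add ga I), !(ds_scal ga I fam), !(ds_mul ga I) by smoothness.
  rewrite (ds_ta ga I fam), (ds_tb ga I fam) by smoothness.
  unfold fadd, fmul, fconst; simpl; ring.
Qed.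

Lemma ds3_tb t x : I t -> ds (ds (ds tb)) t x =
  dsk 2 t x * ta t x - 3 * k t x * dsk 1 t x * tb t x - k t x * k t x * k t x * ta t x.
Proof.
  intro Ht. rewrite (ds_ext ga I _ _ ds2_tb t x Ht).
  rewrite (ds_add ga I), (ds_scal ga I fam), !(ds_mul ga I) by smoothness.
  rewrite (ds_ta ga I fam), (ds_tb ga I fam) by smoothness.
  unfold fadd, fmul, fconst; simpl; ring.
Qed.

Lemma Derive_n_constant_speed P L t f g : I t ->
  (forall x, is_derive P x (L / w t (P x))) -> circle_smooth I f -> eqI I (ds f) g ->
  forall n x, Derive_n (fun x => f t (P x)) (S n) x = L ^ S n * ds_iter ga n g t (P x).
Proof.
  intros Ht HP Hf E n x.
  rewrite (proj2 (Derive_n_reparam ga I fam P L t Ht HP (S n) f Hf)).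
  f_equal. apply (ds_iter_ext n (ds f) g E t (P x) Ht).
Qed.

Lemma elastica_poly_constant_speed mu P L t f g : I t ->
  (forall x, is_derive P x (L / w t (P x))) -> circle_smooth I f -> circle_smooth I g ->
  eqI I (ds f) ta -> eqI I (ds g) tb -> forall x,
  let X n := Derive_n (fun x => f t (P x)) n x in
  let Y n := Derive_n (fun x => g t (P x)) n x in
  elastica_poly mu (X 1%nat) (X 2%nat) (X 3%nat) (X 4%nat)
                   (Y 1%nat) (Y 2%nat) (Y 3%nat) (Y 4%nat) =
  L ^ 9 * (2 * dsk 2 t (P x) + (k t (P x)) ^ 3 - mu * k t (P x)).
Proof.
  intros Ht HP Hf Hg Ef Eg x X Y. unfold X, Y.
  rewrite !(Derive_n_constant_speed P L t f ta Ht HP Hf Ef).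
  rewrite !(Derive_n_constant_speed P L t g tb Ht HP Hg Eg).
  simpl ds_iter. rewrite ds3_ta, ds3_tb by auto.
  rewrite (ds2_ta t (P x) Ht), (ds2_tb t (P x) Ht).
  rewrite (ds_ta ga I fam t (P x) Ht), (ds_tb ga I fam t (P x) Ht).
  unfold fadd, fmul, fconst.
  pose proof (tangent_unit ga I fam t (P x) Ht) as U.
  set (a := ta t (P x)) in *. set (b := tb t (P x)) in *.
  set (k0 := k t (P x)) in *. set (k1 := dsk 1 t (P x)). set (k2 := dsk 2 t (P x)).
  (* the identity is polynomial once the factors [a^2 + b^2 = 1] are restored *)
  set (N := a * a + b * b) in U.
  transitivity (2 * (L ^ 5 * (k2 * N)) * (L ^ 2 * N * (L ^ 2 * N))
    + L ^ 3 * k0 * N * (L ^ 3 * k0 * N) * (L ^ 3 * k0 * N)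
    - mu * (L ^ 3 * k0 * N) * (L ^ 2 * N * (L ^ 2 * N) * (L ^ 2 * N))).
  - unfold elastica_poly, N. ring.
  - rewrite U. ring.
Qed.

End ElasticaPolynomial.

(** The linear variations [c + e eta] stay regular for small [e], hence form a
    family to which the first variation formula applies; at [e = 0] its
    integrand has the elastica operator as a factor. *)
Lemma elastica_of_poly mu (c : R -> R * R) : closed_curve c -> smooth_curve c ->
  forall S0, 0 < S0 ->
  let X n := Derive_n (fun y => fst (c y)) n in
  let Y n := Derive_n (fun y => snd (c y)) n in
  (forall x, X 1%nat x * X 1%nat x + Y 1%nat x * Y 1%nat x = S0) ->
  (forall x, elastica_poly mu (X 1%nat x) (X 2%nat x) (X 3%nat x) (X 4%nat x)
                   (Y 1%nat x) (Y 2%nat x) (Y 3%nat x) (Y 4%nat x) = 0) ->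
  elastica mu c.
Proof.
  intros Hc [Hx Hy] S0 S0p X Y HS HE.
  split; [exact Hc|]. split; [split; assumption|]. split.
  { intros x H. injection H as E1 E2. specialize (HS x). unfold X, Y in HS.
    simpl in HS.
    change (Derive (fun y => fst (c y)) x) with (Derive (fun y => fst (c y)) x) in HS.
    rewrite E1, E2 in HS. lra. }
  intros eta Ec [Ex Ey].
  set (N := fun x => Derive (fun y => fst (eta y)) x * Derive (fun y => fst (eta y)) x
                   + Derive (fun y => snd (eta y)) x * Derive (fun y => snd (eta y)) x).
  destruct (periodic_upper_bound N) as [M HM].
  { intro x. apply (ex_derive_continuous N). unfold N.
    apply @ex_derive_plus; apply ex_derive_mult; first [apply (Ex 2%nat x)|apply (Ey 2%nat x)]. }
  { intro x. unfold N.
    assert (P1 : Derive (fun y => fst (eta y)) (x + 1) = Derive (fun y => fst (eta y)) x).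
    { apply Derive_periodic; [intro y; rewrite Ec; reflexivity|apply (Ex 1%nat)]. }
    assert (P2 : Derive (fun y => snd (eta y)) (x + 1) = Derive (fun y => snd (eta y)) x).
    { apply Derive_periodic; [intro y; rewrite Ec; reflexivity|apply (Ey 1%nat)]. }
    rewrite P1, P2. reflexivity. }
  assert (M0 : 0 <= M).
  { apply Rle_trans with (2 := HM 0). unfold N. nra. }
  (* for these [e] the variation [c + e eta] stays regular *)
  set (I := fun e : R => e * e * (M + 1) < S0).
  set (ga := fun (e : R) x => plus (c x) (scal e (eta x))).
  assert (Iopen : forall e, I e -> locally e I).
  { intros e He.
    apply (continuous_comp (fun e : R => e * e * (M + 1)) (fun z => z) e) with (P := fun z => z < S0).
    - apply (ex_derive_continuous (fun e : R => e * e * (M + 1))). auto_derive. auto.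
    - apply continuous_id.
    - apply (open_lt S0). exact He. }
  assert (Good : forall h k0 : R -> R, smooth h -> smooth k0 -> (forall x, h (x + 1) = h x) ->
     (forall x, k0 (x + 1) = k0 x) -> circle_smooth I (fun e x => h x + e * k0 x)).
  { intros h k0 Sh Sk Ph Pk. split.
    - intro n. apply (class_C_add I Iopen n (fun _ x => h x) (fmul (fun e _ => e) (fun _ x => k0 x))).
      + apply class_C_space; auto.
      + apply class_C_mul; auto; [apply class_C_time; auto|apply class_C_space; auto].
    - intros t x _. rewrite Ph, Pk. reflexivity. }
  assert (fam : family I ga).
  { split.
    - exact Iopen.
    - apply (Good (fun x => fst (c x)) (fun x => fst (eta x))); auto;
        intro x; [rewrite Hc|rewrite Ec]; reflexivity.
    - apply (Good (fun x => snd (c x)) (fun x => snd (eta x))); auto;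
        intro x; [rewrite Hc|rewrite Ec]; reflexivity.
    - intros e He x H.
      assert (E1 : Derive (fun y => fst (ga e y)) x = 0) by exact (f_equal fst H).
      assert (E2 : Derive (fun y => snd (ga e y)) x = 0) by exact (f_equal snd H).
      assert (D1 : Derive (fun y => fst (ga e y)) x
         = Derive (fun y => fst (c y)) x + e * Derive (fun y => fst (eta y)) x).
      { apply is_derive_unique.
        apply (is_derive_plus (fun y => fst (c y)) (fun y => e * fst (eta y))).
        - apply Derive_correct, (Hx 1%nat x).
        - apply is_derive_scal, Derive_correct, (Ex 1%nat x). }
      assert (D2 : Derive (fun y => snd (ga e y)) x
         = Derive (fun y => snd (c y)) x + e * Derive (fun y => snd (eta y)) x).
      { apply is_derive_unique.
        apply (is_derive_plus (fun y => snd (c y)) (fun y => e * snd (eta y))).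
        - apply Derive_correct, (Hy 1%nat x).
        - apply is_derive_scal, Derive_correct, (Ey 1%nat x). }
      rewrite D1 in E1. rewrite D2 in E2.
      specialize (HS x). specialize (HM x). unfold X, Y in HS. simpl in HS.
      unfold N in HM. unfold I in He.
      set (c1 := Derive (fun y => fst (c y)) x) in *.
      set (c2 := Derive (fun y => snd (c y)) x) in *.
      set (e1 := Derive (fun y => fst (eta y)) x) in *.
      set (e2 := Derive (fun y => snd (eta y)) x) in *.
      replace c1 with (- (e * e1)) in HS by lra. replace c2 with (- (e * e2)) in HS by lra.
      pose proof (Rle_0_sqr e) as Qe. unfold Rsqr in Qe.
      assert (e * e * (e1 * e1 + e2 * e2) <= e * e * M) by (apply Rmult_le_compat_l; auto).
      lra. }
  assert (I0 : I 0) by (unfold I; lra).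
  set (L := sqrt S0).
  assert (Lp : 0 < L) by (apply sqrt_lt_R0, S0p).
  assert (W : forall x, w ga 0 x = L).
  { intro x.
    assert (D1 : Derive (fun y => fst (ga 0 y)) x = X 1%nat x).
    { apply Derive_ext. intro y. unfold ga. simpl. unfold plus, scal; simpl; unfold mult; simpl. ring. }
    assert (D2 : Derive (fun y => snd (ga 0 y)) x = Y 1%nat x).
    { apply Derive_ext. intro y. unfold ga. simpl. unfold plus, scal; simpl; unfold mult; simpl. ring. }
    transitivity (sqrt (X 1%nat x * X 1%nat x + Y 1%nat x * Y 1%nat x));
      [|unfold L; f_equal; apply HS].
    rewrite <- D1, <- D2. exact (speed_sqrt (ga 0) x). }
  assert (EL : forall x, 2 * dsk ga 2 0 x + (k ga 0 x) ^ 3 - mu * k ga 0 x = 0).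
  { intro x.
    pose proof (elastica_poly_constant_speed ga I fam mu (fun x => x) L 0 (cx ga) (cy ga) I0)
      as Q.
    specialize (Q ltac:(intro z; rewrite W; unfold Rdiv; rewrite Rinv_r by lra; apply (is_derive_id z))
      (family_fst I ga fam) (family_snd I ga fam)).
    specialize (Q ltac:(intros s z _; reflexivity) ltac:(intros s z _; reflexivity) x).
    cbv beta zeta in Q.
    assert (DX : forall n, Derive_n (fun x => cx ga 0 x) n x = X n x).
    { intro n. apply Derive_n_ext. intro y. unfold cx, ga. simpl.
      unfold plus, scal; simpl; unfold mult; simpl. ring. }
    assert (DY : forall n, Derive_n (fun x => cy ga 0 x) n x = Y n x).
    { intro n. apply Derive_n_ext. intro y. unfold cy, ga. simpl.
      unfold plus, scal; simpl; unfold mult; simpl. ring. }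
    rewrite !DX, !DY, HE in Q.
    assert (0 < L ^ 9) by (apply pow_lt, Lp).
    symmetry in Q. apply Rmult_integral in Q. destruct Q as [Q|Q]; [lra|exact Q]. }
  apply (is_derive_ext (arc_integral ga (fadd (fmul (k ga) (k ga)) (fconst mu)))).
  { intro e. apply RInt_ext. intros x _. unfold fadd, fmul, fconst, k, w, ga.
    simpl. ring. }
  evar_last; [apply (first_variation ga I fam mu 0 I0)|].
  transitivity (RInt (fun _ : R => 0) 0 1).
  - apply RInt_ext. intros x _. unfold fadd, fmul, fconst. specialize (EL x). simpl in EL.
    match goal with |- ?a = ?b => change (@eq R a b) end.
    match goal with |- ?a * ?b * ?d = 0 => replace a with 0 by (simpl; lra) end. ring.
  - rewrite RInt_const. unfold scal; simpl; unfold mult; simpl. ring.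
Qed.

(** * Subconvergence of the elastic flow *)
Lemma class_C_of_ex_diff_n I n : forall f,
  (forall t x, I t -> ex_diff_n f n t x) -> class_C I n f.
Proof.
  induction n as [|n IH]; intros f H.
  - split; [|trivial]. intros t x Ht. apply (H t x Ht).
  - split; [|split; [|split]].
    + intros t x Ht. apply (H t x Ht).
    + intros t x Ht. destruct (H t x Ht) as [_ [A [B _]]]. split; assumption.
    + apply IH. intros t x Ht. apply (H t x Ht).
    + apply IH. intros t x Ht. apply (H t x Ht).
Qed.

Lemma positive_time_open t : positive_time t -> locally t positive_time.
Proof. intro H. apply (open_gt 0 t). exact H. Qed.

Lemma is_derive_of_within f t l : 0 < t ->
  is_derive_within (fun s => 0 <= s) f t l -> is_derive f t l.
Proof.
  intros Ht H. apply is_derive_Reals. intros eps Heps.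
  destruct (H (fun y => Rabs (y - l) < eps)) as [d Hd].
  { exists (mkposreal eps Heps). intros y Hy. exact Hy. }
  assert (dp : 0 < Rmin d t) by (apply Rmin_pos; [apply cond_pos|exact Ht]).
  exists (mkposreal _ dp). intros h Hh Hhd. simpl in Hhd.
  pose proof (Rmin_l d t). pose proof (Rmin_r d t).
  specialize (Hd (t + h)).
  replace (t + h - t) with h in Hd by ring. apply Hd.
  - unfold ball; simpl; unfold AbsRing_ball, abs, minus, plus, opp; simpl.
    replace (t + h + - t) with h by ring. lra.
  - apply Rabs_lt_between in Hhd. split; lra.
Qed.

Lemma elastic_flow_family mu alpha g0 g : elastic_flow mu alpha g0 g ->
  family positive_time g.
Proof.
  intro H. split.
  - apply positive_time_open.
  - split.
    + intro n. apply class_C_of_ex_diff_n. intros t x Ht. apply (flow_smooth _ _ _ _ H), Ht.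
    + intros t x Ht. rewrite (flow_closed _ _ _ _ H t); [reflexivity|apply Rlt_le, Ht].
  - split.
    + intro n. apply class_C_of_ex_diff_n. intros t x Ht. apply (flow_smooth _ _ _ _ H), Ht.
    + intros t x Ht. rewrite (flow_closed _ _ _ _ H t); [reflexivity|apply Rlt_le, Ht].
  - intros t Ht. apply (flow_regular _ _ _ _ H), Rlt_le, Ht.
Qed.

Lemma elastic_flow_velocity mu alpha g0 g : elastic_flow mu alpha g0 g ->
  eqI positive_time (V g) (fadd (fmul (fconst (-2)) (dsk g 2))
   (fadd (fmul (fconst (-1)) (fmul (k g) (fmul (k g) (k g)))) (fmul (fconst mu) (k g)))).
Proof.
  intros H t x Ht.
  destruct (flow_motion _ _ _ _ H t x (Rlt_le _ _ Ht)) as [v [D1 [D2 E]]].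
  apply is_derive_of_within in D1; [|exact Ht]. apply is_derive_of_within in D2; [|exact Ht].
  transitivity (dot v (normal (g t) x)).
  - unfold V, dt. rewrite (is_derive_unique _ _ _ D1 : Derive (fun s => cx g s x) t = fst v).
    rewrite (is_derive_unique _ _ _ D2 : Derive (fun s => cy g s x) t = snd v).
    change (- tb g t x * fst v + ta g t x * snd v
      = fst v * - tb g t x + snd v * ta g t x). ring.
  - rewrite E. unfold fadd, fmul, fconst. simpl.
    change (- (2) * ds g (ds g (k g)) t x - k g t x * (k g t x * (k g t x * 1)) + mu * k g t x
      = -2 * ds g (ds g (k g)) t x + (-1 * (k g t x * (k g t x * k g t x)) + mu * k g t x)).
    ring.
Qed.

Lemma norm_pair_lt (v : R * R) eps : Rabs (fst v) < eps / 2 -> Rabs (snd v) < eps / 2 ->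
  norm v < eps.
Proof.
  intros H1 H2. destruct v as [a b]. simpl in H1, H2.
  unfold norm; simpl; unfold prod_norm; simpl. unfold norm; simpl; unfold abs; simpl.
  pose proof (Rabs_pos a). pose proof (Rabs_pos b).
  rewrite <- (sqrt_Rsqr eps) by lra. apply sqrt_lt_1_alt. unfold Rsqr. nra.
Qed.

Theorem proposition5p1
  (mu alpha : R) (g0 : R -> R * R) (g : R -> R -> R * R)
  (hmu : 0 < mu) (halpha : 0 < alpha < 1)
  (hg : elastic_flow mu alpha g0 g) :
  exists (t : nat -> R) (phi : nat -> R -> R) (p : nat -> R * R)
         (ginf : R -> R * R),
    (forall n, 0 < t n) /\
    (forall n, t n < t (S n)) /\
    is_lim_seq t p_infty /\
    (forall n, reparametrization (phi n)) /\
    elastica mu ginf /\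
    smooth_convergence (fun n x => plus (g (t n) (phi n x)) (p n)) ginf.
Proof.
  pose proof (elastic_flow_family mu alpha g0 g hg) as fam.
  pose proof (elastic_flow_velocity mu alpha g0 g hg) as flow.
  set (I := positive_time) in *.
  pose proof (family_open I g fam) as Iopen.
  pose proof (family_fst I g fam : circle_smooth I (cx g)) as Gx.
  pose proof (family_snd I g fam : circle_smooth I (cy g)) as Gy.
  destruct (dissipative_times g mu hmu fam flow) as [t [t1 [tinc [tN tq]]]].
  assert (tI : forall n, I (t n)) by (intro n; apply positive_time_ge1, t1).
  destruct (functional_choice (fun n P => reparametrization P /\ forall x,
     is_derive P x (curve_length g (t n) / w g (t n) (P x)))) as [P HP].
  { intro n. apply (constant_speed_reparametrization g I fam), tI. }
  set (L := fun n => curve_length g (t n)).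
  set (fx := fun n => fadd (cx g) (fconst (- cx g (t n) (P n 0)))).
  set (fy := fun n => fadd (cy g) (fconst (- cy g (t n) (P n 0)))).
  assert (Gfx : forall n, circle_smooth I (fx n)) by (intro n; unfold fx; smoothness).
  assert (Gfy : forall n, circle_smooth I (fy n)) by (intro n; unfold fy; smoothness).
  assert (dfx : forall n, eqI I (ds g (fx n)) (ta g)).
  { intros n s x Hs. unfold fx. rewrite (ds_add g I) by smoothness.
    rewrite ds_const, ds_cx. ring. }
  assert (dfy : forall n, eqI I (ds g (fy n)) (tb g)).
  { intros n s x Hs. unfold fy. rewrite (ds_add g I) by smoothness.
    rewrite ds_const, ds_cy. ring. }
  set (u := fun n x => fx n (t n) (P n x)).
  set (v := fun n x => fy n (t n) (P n x)).
  assert (Lle : forall n, 0 < L n <= E0 g mu / mu).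
  { intro n; split; [apply (len_pos g I fam), tI|].
    apply (len_le g mu hmu fam flow), t1. }
  assert (Lge : forall n, / (2 * E0 g mu) <= L n).
  { intro n. apply (len_ge g mu hmu fam flow), t1. }
  pose proof (E0_pos g mu hmu fam) as Ep.
  assert (Smooth : forall n f, circle_smooth I f -> smooth (fun x => f (t n) (P n x))).
  { intros n f Gf. apply (smooth_reparam g I fam (P n) (L n)); auto. apply HP. }
  assert (Per : forall n f, circle_smooth I f -> forall x, f (t n) (P n (x + 1)) = f (t n) (P n x)).
  { intros n f Gf x. destruct (HP n) as [[_ [_ Hper]] _]. rewrite Hper. apply Gf, tI. }
  assert (Bound : forall (h : R -> R -> R) (f : nat -> R -> R -> R),
    (forall n, circle_smooth I (f n)) -> (forall n, eqI I (ds g (f n)) h) ->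
    (forall n, f n (t n) (P n 0) = 0) -> (forall s x, I s -> Rabs (h s x) <= 1) ->
    (forall m, ds_bounded g m h) ->
    forall m, exists C, forall n x, Rabs (Derive_n (fun x => f n (t n) (P n x)) m x) <= C).
  { intros h f Gf df f0 h1 hb m. destruct m as [|m].
    - exists (E0 g mu / mu). intros n x. simpl.
      replace (f n (t n) (P n x)) with (f n (t n) (P n x) - f n (t n) (P n 0))
        by (rewrite f0; ring).
      apply Rle_trans with (L n); [|apply Lle].
      apply (oscillation_J g I fam (f n) (fconst 1)); smoothness.
      intro z. rewrite df by apply tI. apply h1, tI.
    - destruct (ds_iter_bounded g m h (hb m)) as [C B].
      exists ((E0 g mu / mu) ^ S m * C). intros n x.
      rewrite (Derive_n_constant_speed g I fam (P n) (L n) (t n) (f n) h (tI n)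
        (proj2 (HP n)) (Gf n) (df n)).
      rewrite Rabs_mult. apply Rmult_le_compat; auto using Rabs_pos.
      rewrite Rabs_pos_eq by (apply pow_le; apply Rlt_le, Lle).
      apply pow_incr. split; [apply Rlt_le, Lle|apply Lle]. }
  destruct (smooth_compactness u) as [e1 [l1 [He1 [Sl1 Lim1]]]].
  { intro n. apply Smooth, Gfx. }
  { intro n. apply Per, Gfx. }
  { apply (Bound (ta g) fx); auto.
    - intro n. unfold fx, fadd, fconst. ring.
    - intros s x Hs. apply (tangent_bound g fam), Hs.
    - intro m. apply (ds_bounded_tangent g mu hmu fam flow). }
  destruct (smooth_compactness (fun n => v (e1 n))) as [e2 [l2 [He2 [Sl2 Lim2]]]].
  { intro n. apply Smooth, Gfy. }
  { intro n. apply Per, Gfy. }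
  { intro m. destruct (Bound (tb g) fy) with (m := m) as [C B]; auto.
    - intro n. unfold fy, fadd, fconst. ring.
    - intros s x Hs. apply (tangent_bound g fam), Hs.
    - intro m'. apply (ds_bounded_tangent g mu hmu fam flow).
    - exists C. intros n x. apply B. }
  set (e := fun n => e1 (e2 n)).
  assert (He : extraction e) by exact (extraction_comp e1 e2 He1 He2).
  assert (LimX : smooth_limit (fun n => u (e n)) l1).
  { exact (smooth_limit_extraction _ _ e2 He2 Lim1). }
  assert (LimY : smooth_limit (fun n => v (e n)) l2) by exact Lim2.
  set (X := fun m x => Derive_n l1 m x). set (Y := fun m x => Derive_n l2 m x).
  assert (PX : forall m x, is_lim_seq (fun n => Derive_n (u (e n)) m x) (X m x))
    by (intros; apply (smooth_limit_pointwise _ l1 m x LimX)).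
  assert (PY : forall m x, is_lim_seq (fun n => Derive_n (v (e n)) m x) (Y m x))
    by (intros; apply (smooth_limit_pointwise _ l2 m x LimY)).
  assert (UL : forall (a b : nat -> R) (la lb : R), (forall n, a n = b n) ->
     is_lim_seq a la -> is_lim_seq b lb -> la = lb).
  { intros a b la lb E Ha Hb. apply (is_lim_seq_ext _ _ _ E) in Ha.
    apply is_lim_seq_unique in Ha. apply is_lim_seq_unique in Hb.
    rewrite Ha in Hb. injection Hb; auto. }
  (* the limit inherits constant speed *)
  set (S0 := X 1%nat 0 * X 1%nat 0 + Y 1%nat 0 * Y 1%nat 0).
  assert (Speed : forall n x, Derive_n (u n) 1 x * Derive_n (u n) 1 x
       + Derive_n (v n) 1 x * Derive_n (v n) 1 x = L n * L n).
  { intros n x. unfold u, v.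
    rewrite (Derive_n_constant_speed g I fam (P n) (L n) (t n) (fx n) (ta g) (tI n)
      (proj2 (HP n)) (Gfx n) (dfx n) 0).
    rewrite (Derive_n_constant_speed g I fam (P n) (L n) (t n) (fy n) (tb g) (tI n)
      (proj2 (HP n)) (Gfy n) (dfy n) 0).
    simpl ds_iter.
    transitivity (L n * L n * (ta g (t n) (P n x) * ta g (t n) (P n x)
      + tb g (t n) (P n x) * tb g (t n) (P n x))); [ring|].
    rewrite (tangent_unit g I fam) by apply tI. ring. }
  assert (PS : forall x, is_lim_seq (fun n => L (e n) * L (e n))
      (X 1%nat x * X 1%nat x + Y 1%nat x * Y 1%nat x)).
  { intro x. apply (is_lim_seq_ext (fun n =>
      Derive_n (u (e n)) 1 x * Derive_n (u (e n)) 1 x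
       + Derive_n (v (e n)) 1 x * Derive_n (v (e n)) 1 x)); [intro n; apply Speed|].
    apply is_lim_seq_plus'; apply is_lim_seq_mult'; auto. }
  assert (HS : forall x, X 1%nat x * X 1%nat x + Y 1%nat x * Y 1%nat x = S0).
  { intro x. apply (UL _ _ _ _ (fun n => eq_refl) (PS x) (PS 0)). }
  assert (ip : 0 < / (2 * E0 g mu)) by (apply Rinv_0_lt_compat; lra).
  assert (S0p : 0 < S0).
  { apply Rlt_le_trans with (/ (2 * E0 g mu) * / (2 * E0 g mu)); [nra|].
    apply (is_lim_seq_le (fun _ => / (2 * E0 g mu) * / (2 * E0 g mu))
      (fun n => L (e n) * L (e n)) (Finite _) (Finite _)); [|apply is_lim_seq_const|apply PS].
    intro n. specialize (Lge (e n)). apply Rmult_le_compat; lra. }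
  (* the elastica equation passes to the limit since the velocity vanishes *)
  assert (Zero : forall x, elastica_poly mu (X 1%nat x) (X 2%nat x) (X 3%nat x) (X 4%nat x)
      (Y 1%nat x) (Y 2%nat x) (Y 3%nat x) (Y 4%nat x) = 0).
  { intro x.
    set (a := fun n => elastica_poly mu
      (Derive_n (u (e n)) 1 x) (Derive_n (u (e n)) 2 x) (Derive_n (u (e n)) 3 x)
      (Derive_n (u (e n)) 4 x) (Derive_n (v (e n)) 1 x) (Derive_n (v (e n)) 2 x)
      (Derive_n (v (e n)) 3 x) (Derive_n (v (e n)) 4 x)).
    assert (La : is_lim_seq a (elastica_poly mu (X 1%nat x) (X 2%nat x) (X 3%nat x) (X 4%nat x)
      (Y 1%nat x) (Y 2%nat x) (Y 3%nat x) (Y 4%nat x))).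
    { apply elastica_poly_lim; auto. }
    assert (L0 : is_lim_seq a 0).
    { apply is_lim_seq_spec. intro eps.
      set (M := (E0 g mu / mu) ^ 9).
      assert (Mp : 0 < M) by (apply pow_lt, Rdiv_lt_0_compat; lra).
      destruct (V_vanishes g mu hmu fam flow t t1 tq (eps / M)) as [N HN].
      { apply Rdiv_lt_0_compat; [apply cond_pos|exact Mp]. }
      exists N. intros n Hn.
      pose proof (extraction_ge e He n) as Hen.
      specialize (HN (e n) ltac:(lia) (P (e n) x)).
      rewrite Rminus_0_r.
      assert (Ea : a n = L (e n) ^ 9 * (- V g (t (e n)) (P (e n) x))).
      { unfold a, u, v.
        rewrite (elastica_poly_constant_speed g I fam mu (P (e n)) (L (e n)) (t (e n))
          (fx (e n)) (fy (e n)) (tI (e n)) (proj2 (HP (e n))) (Gfx (e n)) (Gfy (e n))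
          (dfx (e n)) (dfy (e n)) x).
        f_equal. rewrite (flow (t (e n)) (P (e n) x) (tI (e n))).
        unfold fadd, fmul, fconst. ring. }
      rewrite Ea, Rabs_mult, Rabs_Ropp.
      assert (LM : Rabs (L (e n) ^ 9) <= M).
      { rewrite Rabs_pos_eq by (apply pow_le, Rlt_le, Lle).
        apply pow_incr. split; [apply Rlt_le, Lle|apply Lle]. }
      apply Rle_lt_trans with (M * Rabs (V g (t (e n)) (P (e n) x))).
      - apply Rmult_le_compat_r; [apply Rabs_pos|exact LM].
      - apply Rlt_le_trans with (M * (eps / M)); [apply Rmult_lt_compat_l; auto|].
        apply Req_le. field. lra. }
    apply (UL _ _ _ _ (fun n => eq_refl) La L0). }
  exists (fun n => t (e n)), (fun n => P (e n)),
    (fun n => (- cx g (t (e n)) (P (e n) 0), - cy g (t (e n)) (P (e n) 0))),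
    (fun x => (l1 x, l2 x)).
  assert (tmono : forall n m, (n < m)%nat -> t n < t m).
  { intros n m H. induction H as [|m H IH]; [apply tinc|].
    apply Rlt_trans with (1 := IH), tinc. }
  split; [|split; [|split; [|split; [|split]]]].
  - intro n. apply tI.
  - intro n. apply tmono, He.
  - apply (is_lim_seq_le_p_loc INR); [|apply is_lim_seq_INR].
    exists O. intros n _. apply Rle_trans with (2 := tN (e n)).
    apply le_INR, extraction_ge, He.
  - intro n. apply HP.
  - apply (elastica_of_poly mu _) with (S0 := S0); auto.
    + intro x. f_equal.
      * apply (UL (fun n => Derive_n (u (e n)) 0 (x + 1)) (fun n => Derive_n (u (e n)) 0 x)
          (l1 (x + 1)) (l1 x)); [|apply (PX 0%nat)|apply (PX 0%nat)].
        intro n. apply Per, Gfx.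
      * apply (UL (fun n => Derive_n (v (e n)) 0 (x + 1)) (fun n => Derive_n (v (e n)) 0 x)
          (l2 (x + 1)) (l2 x)); [|apply (PY 0%nat)|apply (PY 0%nat)].
        intro n. apply Per, Gfy.
    + split; [exact Sl1|exact Sl2].
  - intros m eps Heps.
    destruct (LimX m (eps / 2)) as [N1 H1]; [lra|].
    destruct (LimY m (eps / 2)) as [N2 H2]; [lra|].
    exists (N1 + N2)%nat. intros n Hn x. apply norm_pair_lt.
    + apply (H1 n ltac:(lia) x).
    + apply (H2 n ltac:(lia) x).
Qed.
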